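(* Let $\Psi$ be a commuting interaction on a finite graph $\Lambda$ with Hamiltonian $H=\sum_{Z\subset\Lambda}\Psi(Z)$, let $X\subset\Lambda$ and $V\in\mathcal{A}_X$ self-adjoint. Assume that for every $\lambda\in[0,1]$, $H+\lambda V$ has a unique ground state $\rho_\lambda$ and a spectral gap of size at least $g>0$ above the ground state energy. For $Y\subset\Lambda$, $B\in\mathcal{A}_Y$ write $r=\mathrm{dist}(X,Y)$. (a) If $\|\Psi\|_{F_\alpha}<\infty$ for some $\alpha>0$, where $F_\alpha(r)=(1+r)^{-\alpha}$, then for all $Y\subset\Lambda$ and $B\in\mathcal{A}_Y$, $$\big|\mathrm{tr}(\rho_0B)-\mathrm{tr}(\rho_1B)\big|\le 32\,\|\Psi\|_{F_\alpha}\,\|B\|\,(\|V\|+\|V\|^2)\,|X|\,|Y|\,F_\alpha(r)\,\frac{g+2}{g^3}.$$ (b) Suppose $\Lambda$ is a $(\kappa,D)$-regular graph and $\|\Psi\|_{F_{b,p}}<\infty$ for some $b>b'>0$, $p\in(0,1]$, where $F_{b,p}(r)=e^{-br^p}$. Then there is a constant $C_{b,b'}>0$ depending only on $b,b',p,\kappa,D$ (the constant of the short-range commuting Lieb–Robinson bound) such that for all $Y\subset\Lambda$ and $B\in\mathcal{A}_Y$, $$\big|\mathrm{tr}(\rho_0B)-\mathrm{tr}(\rho_1B)\big|\le 8\,C_{b,b'}\,\|\Psi\|_{F_{b,p}}\,\|B\|\,(\|V\|+\|V\|^2)\,\min\{|X|,|Y|\}\,F_{b',p}(r)\,\frac{g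+2}{g^3}.$$
   Context: $\Lambda$ has graph distance $d$; it is $(\kappa,D)$-regular if $|\{z:d(x,z)\le r\}|\le(1+\kappa)r^D$ for all $x$ and $r\in\mathbb{N}_{>0}$. Each site carries $\mathbb{C}^q$, $\mathcal{A}_Z=\mathcal{B}(\bigotimes_{x\in Z}\mathbb{C}^q)$ embedded in $\mathcal{A}_\Lambda$ via $A\mapsto A\otimes\mathbf{1}$. An interaction assigns to each $Z\subset\Lambda$ a self-adjoint $\Psi(Z)\in\mathcal{A}_Z$; commuting means $[\Psi(Z),\Psi(Z')]=0$ for all $Z,Z'$ (no commutation between $V$ and $H$ is assumed). $\|\Psi\|_F=\sup_{x,y\in\Lambda}\sum_{Z\ni x,y}\|\Psi(Z)\|/F(d(x,y))$. $\rho_\lambda$ denotes the ground-state density matrix (projection onto the unique ground state). *)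

(* Defs.v *)
From HB Require Import structures.
From mathcomp Require Import all_boot all_order all_algebra.
From mathcomp Require Import classical_sets reals.
From mathcomp.analysis Require Import sequences exp.
From mathcomp.real_closed Require Import complex.

Set Implicit Arguments.
Unset Strict Implicit.
Unset Printing Implicit Defensive.

Import Order.TTheory GRing.Theory Num.Theory.
Local Open Scope ring_scope.

Fixpoint within (T : finType) (e : rel T) (n : nat) (x y : T) : bool :=
  match n with
  | 0 => x == y
  | n'.+1 => within e n' x y || [exists z, within e n' x z && e z y]
  end.

(* graph distance (for a connected graph, shortest paths have length < #|T|) *)
Definition gdist (T : finType) (e : rel T) (x y : T) : nat :=
  find (fun n => within e n x y) (iota 0 #|T|).

Definition setdist (T : finType) (e : rel T) (X Y : {set T}) : nat :=
  \big[minn/#|T|]_(x in X) \big[minn/#|T|]_(y in Y) gdist e x y.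

Definition simple_connected_graph (T : finType) (e : rel T) : Prop :=
  symmetric e /\ irreflexive e /\ (forall x y : T, connect e x y).

Definition kD_regular (R : realType) (T : finType) (e : rel T) (kappa D : R)
  : Prop :=
  forall (x : T) (r : nat), (0 < r)%N ->
    (#|[set z | (gdist e x z <= r)%N]|%:R : R) <= (1 + kappa) * powR (r%:R) D.

(* Quantum spin system: each site carries C^q; the total Hilbert space *)
(* has the product basis indexed by configurations T -> 'I_q; matrices *)
(* are indexed through enum_rank of configurations.                    *)

Definition conf (T : finType) (q : nat) := {ffun T -> 'I_q}.

Definition dimH (T : finType) (q : nat) : nat := #|conf T q|.

Definition obs (R : realType) (T : finType) (q : nat) :=
  'M[R[i]]_(dimH T q).

Definition entry (R : realType) (T : finType) (q : nat) (A : obs R T q)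
  (s t : conf T q) : R[i] := A (enum_rank s) (enum_rank t).

Definition agree_on (T : finType) (q : nat) (Z : {set T}) (s t : conf T q) :=
  [forall x in Z, s x == t x].

(* A lies in A_Z (embedded as a (x) 1): entries are a(s|Z, t|Z) times
   the Kronecker delta of the configurations off Z. *)
Definition supported (R : realType) (T : finType) (q : nat) (Z : {set T})
  (A : obs R T q) : Prop :=
  exists a : conf T q -> conf T q -> R[i],
    (forall s s' t t', agree_on Z s s' -> agree_on Z t t' -> a s t = a s' t')
    /\ forall s t, entry A s t =
                   (if agree_on (~: Z) s t then a s t else 0).

Definition adj (m n : nat) (R : realType) (A : 'M[R[i]]_(m, n)) : 'M[R[i]]_(n, m) :=
  (map_mx conjc A)^T.

Definition selfadj (n : nat) (R : realType) (A : 'M[R[i]]_n) : Prop :=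
  adj A = A.

Definition vnorm (n : nat) (R : realType) (v : 'cV[R[i]]_n) : R :=
  Num.sqrt (\sum_i (ComplexField.Normc.normc (v i 0)) ^+ 2).

Definition opnorm (n : nat) (R : realType) (A : 'M[R[i]]_n) : R :=
  sup [set r : R | exists v : 'cV[R[i]]_n, vnorm v <= 1 /\ r = vnorm (A *m v)].

Definition unique_gs_gap (n : nat) (R : realType) (A : 'M[R[i]]_n) (g : R)
  : Prop :=
  exists E : R,
    eigenvalue A (E%:C)%C
    /\ \rank (eigenspace A (E%:C)%C) = 1%N
    /\ forall mu : R[i], eigenvalue A mu -> mu = (E%:C)%C \/ ((E + g)%:C)%C <= mu.

Definition ground_state_proj (n : nat) (R : realType) (A rho : 'M[R[i]]_n)
  : Prop :=
  exists (psi : 'cV[R[i]]_n) (E : R),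
    vnorm psi = 1
    /\ A *m psi = (E%:C)%C *: psi
    /\ (forall mu : R[i], eigenvalue A mu -> (E%:C)%C <= mu)
    /\ rho = psi *m adj psi.

Definition interaction (R : realType) (T : finType) (q : nat) :=
  {set T} -> obs R T q.

Definition is_interaction (R : realType) (T : finType) (q : nat)
  (Psi : interaction R T q) : Prop :=
  forall Z, selfadj (Psi Z) /\ supported Z (Psi Z).

Definition commuting (R : realType) (T : finType) (q : nat)
  (Psi : interaction R T q) : Prop :=
  forall Z Z', Psi Z *m Psi Z' = Psi Z' *m Psi Z.

Definition hamiltonian (R : realType) (T : finType) (q : nat)
  (Psi : interaction R T q) : obs R T q :=
  \sum_(Z : {set T}) Psi Z.

Definition Fnorm (R : realType) (T : finType) (e : rel T) (q : nat)
  (F : nat -> R) (Psi : interaction R T q) : R :=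
  \big[Num.max/0]_(x : T) \big[Num.max/0]_(y : T)
     ((\sum_(Z : {set T} | (x \in Z) && (y \in Z)) opnorm (Psi Z))
        / F (gdist e x y)).

Definition F_poly (R : realType) (alpha : R) (r : nat) : R :=
  powR (1 + r%:R) (- alpha).

Definition F_exp (R : realType) (b p : R) (r : nat) : R :=
  expR (- (b * powR (r%:R) p)).

Definition trace_diff (R : realType) (T : finType) (q : nat)
  (rho0 rho1 B : obs R T q) : R :=
  ComplexField.Normc.normc (\tr (rho0 *m B) - \tr (rho1 *m B)).

(* Main.v *)
(** Write [H = M + C], where [C] collects the terms [Psi Z] with [Z] disjoint
    from [X]; then [C] commutes with [M] and with [V].  Let [psi] and [phi] be
    the ground states of [H + lam V] and [H + mu V], and let [chi] be the part
    of [phi] orthogonal to [psi].  By the gap, [|chi| <= 2 |mu - lam| |V| / g].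
    Unless [phi] is orthogonal to [psi], [C] has the same eigenvalue on [psi],
    [phi] and [chi], so that with [w] the reduced resolvent of [H + lam V]
    applied to [chi], [<psi, B chi> = <psi, [B, M + lam V] w>] and
    [|w| <= |chi| / g].  The terms of [M] disjoint from [Y] commute with [B],
    so only the terms [Psi Z] with [Z] meeting both [X] and [Y] enter the
    commutator, together with [V] when [X] and [Y] overlap.  In the latter case
    a flip of one spin in the overlap costs energy at most twice the norm of the
    terms at that site, so that [g] is at most twice the interaction norm.
    No time evolution or Lieb-Robinson bound is involved. *)

Require Import Defs.
From HB Require Import structures.
From mathcomp Require Import all_boot all_order all_algebra.
From mathcomp Require Import ring lra zify.
From mathcomp Require Import classical_sets reals.
From mathcomp.analysis Require Import sequences exp.
From mathcomp.real_closed Require Import complex.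

Import Order.TTheory GRing.Theory Num.Theory.
Local Open Scope ring_scope.

Set Implicit Arguments.
Unset Strict Implicit.
Unset Printing Implicit Defensive.

Local Notation normc := ComplexField.Normc.normc.

(** * Inner product, Euclidean norm and operator norm on complex vectors *)

Section HilbertSpace.
Variable R : realType.
Implicit Types (x : R[i]).

Lemma normc_ge0 x : 0 <= normc x.
Proof. by case: x => a b; apply: sqrtr_ge0. Qed.

Lemma sqr_normcE x : ((normc x ^+ 2)%:C)%C = conjc x * x.
Proof. by rewrite rmorphXn /= mulrC -sqr_normc. Qed.

Lemma normc_conjc x : normc (conjc x) = normc x.
Proof. by case: x => a b /=; rewrite sqrrN. Qed.

Lemma normcN x : normc (- x) = normc x.
Proof. by case: x => a b /=; rewrite !sqrrN. Qed.

Lemma Re_le_normc x : complex.Re x <= normc x.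
Proof.
case: x => a b /=; apply: (le_trans (ler_norm a)).
by rewrite -sqrtr_sqr ler_wsqrtr // lerDl sqr_ge0.
Qed.

Lemma normc_real (a : R) : normc (a%:C)%C = `|a|.
Proof. by rewrite /= expr0n /= addr0 sqrtr_sqr. Qed.

Section Adjoint.
Variables m n p : nat.

Lemma adjD (A B : 'M[R[i]]_(m, n)) : adj (A + B) = adj A + adj B.
Proof. by rewrite /adj map_mxD linearD. Qed.

Lemma adjB (A B : 'M[R[i]]_(m, n)) : adj (A - B) = adj A - adj B.
Proof. by rewrite /adj map_mxB linearB. Qed.

Lemma adjZ x (A : 'M[R[i]]_(m, n)) : adj (x *: A) = conjc x *: adj A.
Proof. by rewrite /adj map_mxZ linearZ. Qed.

Lemma adjM (A : 'M[R[i]]_(m, n)) (B : 'M[R[i]]_(n, p)) :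
  adj (A *m B) = adj B *m adj A.
Proof. by rewrite /adj map_mxM trmx_mul. Qed.

Lemma adjK (A : 'M[R[i]]_(m, n)) : adj (adj A) = A.
Proof. by apply/matrixP => i j; rewrite !mxE conjcK. Qed.

Lemma adj_eq0 (A : 'M[R[i]]_(m, n)) : (adj A == 0) = (A == 0).
Proof.
apply/eqP/eqP => [z|->]; last by rewrite /adj map_mx0 trmx0.
by rewrite -(adjK A) z /adj map_mx0 trmx0.
Qed.

End Adjoint.

Section Vectors.
Variable n : nat.
Implicit Types (u v w : 'cV[R[i]]_n) (A B : 'M[R[i]]_n).

Definition dot u v : R[i] := (adj u *m v) 0 0.

Lemma dot_sum u v : dot u v = \sum_i conjc (u i 0) * v i 0.
Proof. by rewrite /dot mxE; apply: eq_bigr => i _; rewrite !mxE. Qed.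

Lemma dotDl u v w : dot (u + v) w = dot u w + dot v w.
Proof. by rewrite /dot adjD mulmxDl mxE. Qed.
Lemma dotDr u v w : dot w (u + v) = dot w u + dot w v.
Proof. by rewrite /dot mulmxDr mxE. Qed.
Lemma dotBl u v w : dot (u - v) w = dot u w - dot v w.
Proof. by rewrite /dot adjB mulmxBl !mxE. Qed.
Lemma dotBr u v w : dot w (u - v) = dot w u - dot w v.
Proof. by rewrite /dot mulmxBr !mxE. Qed.
Lemma dotZl x u v : dot (x *: u) v = conjc x * dot u v.
Proof. by rewrite /dot adjZ -scalemxAl mxE. Qed.
Lemma dotZr x u v : dot u (x *: v) = x * dot u v.
Proof. by rewrite /dot -scalemxAr mxE. Qed.
Lemma dot0r u : dot u 0 = 0.
Proof. by rewrite /dot mulmx0 mxE. Qed.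
Lemma dot_conj u v : conjc (dot u v) = dot v u.
Proof.
rewrite !dot_sum rmorph_sum; apply: eq_bigr => i _.
by rewrite rmorphM /= conjcK mulrC.
Qed.
Lemma dot_adj A u v : dot (A *m u) v = dot u (adj A *m v).
Proof. by rewrite /dot adjM mulmxA. Qed.
Lemma dot_selfadj A u v : selfadj A -> dot (A *m u) v = dot u (A *m v).
Proof. by move=> sA; rewrite dot_adj sA. Qed.

Lemma vnorm_ge0 v : 0 <= vnorm v.
Proof. exact: sqrtr_ge0. Qed.
Hint Resolve vnorm_ge0 : core.

Lemma vnorm_sqr v : vnorm v ^+ 2 = \sum_i normc (v i 0) ^+ 2.
Proof. by rewrite sqr_sqrtr // sumr_ge0 // => i _; apply: sqr_ge0. Qed.

Lemma dot_vnorm v : dot v v = ((vnorm v ^+ 2)%:C)%C.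
Proof.
by rewrite vnorm_sqr rmorph_sum dot_sum; apply: eq_bigr => i _ /=; rewrite sqr_normcE.
Qed.

Lemma vnorm0 : vnorm (0 : 'cV[R[i]]_n) = 0.
Proof.
apply/eqP; rewrite -sqrf_eq0 vnorm_sqr big1 // => i _.
by rewrite mxE ComplexField.Normc.normc0 expr0n.
Qed.

Lemma vnorm_eq0 v : vnorm v = 0 -> v = 0.
Proof.
move=> v0; apply/matrixP => i j; rewrite ord1 mxE.
apply: ComplexField.Normc.eq0_normc; apply/eqP; rewrite -sqrf_eq0; apply/eqP.
have := vnorm_sqr v; rewrite v0 expr0n /= => /esym/eqP.
by rewrite psumr_eq0 => [/allP/(_ i (mem_index_enum _))/eqP//|k _]; apply: sqr_ge0.
Qed.

Lemma vnormZ x v : vnorm (x *: v) = normc x * vnorm v.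
Proof.
apply/eqP; rewrite -(@eqrXn2 _ 2) ?mulr_ge0 ?normc_ge0 // exprMn !vnorm_sqr.
rewrite mulr_sumr; apply/eqP/eq_bigr => i _.
by rewrite mxE ComplexField.Normc.normcM exprMn.
Qed.

Lemma vnormN v : vnorm (- v) = vnorm v.
Proof. by rewrite -scaleN1r vnormZ normcN ComplexField.Normc.normc1 mul1r. Qed.

(** With [N] the squared norm of [u] and [d] the inner product, the vector [N v - d u] has squared
    norm [N (N |v|^2 - |d|^2)], which is nonnegative. *)
Lemma cauchy_schwarz u v : normc (dot u v) <= vnorm u * vnorm v.
Proof.
have [u0|uN0] := eqVneq (vnorm u) 0.
  by rewrite u0 (vnorm_eq0 u0) -dot_conj dot0r normc_conjc ComplexField.Normc.normc0 mul0r.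
have u_gt0 : 0 < vnorm u by rewrite lt_def uN0 vnorm_ge0.
rewrite -(@ler_pXn2r _ 2) ?nnegrE ?mulr_ge0 ?normc_ge0 // exprMn.
set N := vnorm u ^+ 2; set d := dot u v.
have N_gt0 : 0 < N by rewrite exprn_gt0.
have : ((vnorm ((N%:C)%C *: v - d *: u) ^+ 2)%:C)%C
       = ((N * (N * vnorm v ^+ 2 - normc d ^+ 2))%:C)%C :> R[i].
  rewrite -dot_vnorm dotBl !dotBr !dotZl !dotZr !dot_vnorm -[dot v u]dot_conj.
  rewrite -/d -/N conjc_real !rmorphM !rmorphB !rmorphM /=.
  by have := sqr_normcE d; rewrite rmorphM /= => ->; ring.
move=> /complexI e; rewrite -subr_ge0 -(pmulr_rge0 _ N_gt0).
rewrite -[X in _ <= X]e.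
exact: sqr_ge0.
Qed.

Lemma vnormD u v : vnorm (u + v) <= vnorm u + vnorm v.
Proof.
rewrite -(@ler_pXn2r _ 2) ?nnegrE ?addr_ge0 //.
have : dot (u + v) (u + v)
     = ((vnorm u ^+ 2 + vnorm v ^+ 2 + 2 * complex.Re (dot u v))%:C)%C.
  rewrite dotDl !dotDr !dot_vnorm -[dot v u]dot_conj !rmorphD !rmorphM /=.
  have := addcJ (dot u v); rewrite rmorph_nat => <-; ring.
rewrite dot_vnorm => /complexI ->.
have := le_trans (Re_le_normc _) (cauchy_schwarz u v); nra.
Qed.

Lemma vnormB u v : vnorm (u - v) <= vnorm u + vnorm v.
Proof. by rewrite (le_trans (vnormD _ _)) // vnormN. Qed.

Lemma vnorm_sum (I : finType) (P : pred I) (F : I -> 'cV[R[i]]_n) :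
  vnorm (\sum_(i | P i) F i) <= \sum_(i | P i) vnorm (F i).
Proof.
elim/big_ind2 : _ => //; first by rewrite vnorm0.
by move=> u a v b ua vb; rewrite (le_trans (vnormD _ _)) // lerD.
Qed.

Lemma normc_entry_le_vnorm v i : normc (v i 0) <= vnorm v.
Proof.
rewrite -(@ler_pXn2r _ 2) ?nnegrE ?normc_ge0 // vnorm_sqr (bigD1 i) //= lerDl.
by rewrite sumr_ge0 // => k _; apply: sqr_ge0.
Qed.

(** The sum of the column norms is an upper bound, so the [sup] in [opnorm] is a true supremum and
    not a default value. *)
Lemma has_sup_opnorm A :
  has_sup [set r : R | exists v : 'cV[R[i]]_n, vnorm v <= 1 /\ r = vnorm (A *m v)].
Proof.
split; first by exists (vnorm (A *m (0 : 'cV_n))), 0; rewrite vnorm0.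
exists (\sum_j vnorm (col j A)) => _ [v [v1 ->]].
have -> : A *m v = \sum_j v j 0 *: col j A.
  apply/matrixP => i k; rewrite ord1 mxE summxE; apply: eq_bigr => j _.
  by rewrite !mxE mulrC.
apply: (le_trans (vnorm_sum _ _)); apply: ler_sum => j _.
rewrite vnormZ ler_piMl //; exact: le_trans (normc_entry_le_vnorm _ _) v1.
Qed.

Lemma opnorm_ge0 A : 0 <= opnorm A.
Proof.
apply: (@le_trans _ _ (vnorm (A *m (0 : 'cV_n)))) => //.
by apply: ub_le_sup; [case: (has_sup_opnorm A) | exists 0; rewrite vnorm0].
Qed.

Lemma vnorm_mul_le A v : vnorm (A *m v) <= opnorm A * vnorm v.
Proof.
have [v0|vN0] := eqVneq (vnorm v) 0.
  by rewrite (vnorm_eq0 v0) mulmx0 !vnorm0 mulr0.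
have v_gt0 : 0 < vnorm v by rewrite lt_def vN0 vnorm_ge0.
rewrite -ler_pdivrMr // mulrC.
have /ger0_norm <- : 0 <= (vnorm v)^-1 by rewrite invr_ge0.
rewrite -normc_real -vnormZ scalemxAr.
apply: ub_le_sup; first by case: (has_sup_opnorm A).
exists (((vnorm v)^-1)%:C%C *: v); split => //.
by rewrite vnormZ normc_real ger0_norm ?invr_ge0 // mulVf.
Qed.

Lemma opnorm_le A (k : R) :
  0 <= k -> (forall v, vnorm (A *m v) <= k * vnorm v) -> opnorm A <= k.
Proof.
move=> k0 h; apply: ge_sup; first by case: (has_sup_opnorm A).
by move=> _ [v [v1 ->]]; apply: (le_trans (h v)); rewrite ler_piMr.
Qed.

Lemma opnorm_sum (I : finType) (P : pred I) (F : I -> 'M[R[i]]_n) :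
  opnorm (\sum_(i | P i) F i) <= \sum_(i | P i) opnorm (F i).
Proof.
apply: opnorm_le => [|v]; first by apply: sumr_ge0 => i _; apply: opnorm_ge0.
rewrite mulmx_suml (le_trans (vnorm_sum _ _)) // mulr_suml.
by apply: ler_sum => i _; apply: vnorm_mul_le.
Qed.

Lemma dot_mul_le A u v : normc (dot u (A *m v)) <= vnorm u * (opnorm A * vnorm v).
Proof.
by apply: (le_trans (cauchy_schwarz _ _)); rewrite ler_wpM2l // vnorm_mul_le.
Qed.

End Vectors.
End HilbertSpace.

(** * Spectral theorem, gapped ground states and the reduced resolvent *)

Section Spectral.
Variables (R : realType) (n : nat).
Implicit Types (A : 'M[R[i]]_n) (v psi : 'cV[R[i]]_n).

Lemma selfadj_diagonalizable A : selfadj A ->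
  exists (U : 'M[R[i]]_n) (d : 'rV[R[i]]_n),
    [/\ adj U *m U = 1%:M, U *m adj U = 1%:M & A = adj U *m diag_mx d *m U].
Proof.
move=> sA; have tC (B : 'M[R[i]]_n) : map_mx Num.conj (B^T) = adj B.
  by apply/matrixP => i j; rewrite !mxE.
have : A \is normalmx by apply/normalmxP; rewrite !tC sA.
move=> /orthomx_spectralP; set U := spectralmx A => eA.
have uU : U \is unitarymx := spectral_unitarymx A.
have eU : invmx U = adj U by rewrite invmx_unitary // tC.
exists U, (spectral_diag A); split; last by rewrite -eU.
- by rewrite -eU mulVmx // spectral_unit.
- by rewrite -eU mulmxV // spectral_unit.
Qed.

Lemma vnorm_isometry (U : 'M[R[i]]_n) v : adj U *m U = 1%:M -> vnorm (U *m v) = vnorm v.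
Proof.
move=> uU; apply/eqP; rewrite -(@eqrXn2 _ 2) ?vnorm_ge0 //; apply/eqP.
by apply: complexI; rewrite -!dot_vnorm dot_adj mulmxA uU mul1mx.
Qed.


(** The data of [unique_gs_gap] with the energy and a unit vector named. The vector is a column,
    whereas [eigenvalue] and [eigenspace] concern row vectors; taking adjoints passes between the
    two. *)
Definition gapped_ground_state A (g : R) (psi : 'cV[R[i]]_n) (E : R) :=
  [/\ vnorm psi = 1, A *m psi = (E%:C)%C *: psi,
      \rank (eigenspace A (E%:C)%C) = 1%N &
      forall mu : R[i], eigenvalue A mu -> mu = (E%:C)%C \/ ((E + g)%:C)%C <= mu].

Lemma eigenvalue_selfadj A psi (E : R) : selfadj A -> psi != 0 ->
  A *m psi = (E%:C)%C *: psi -> eigenvalue A (E%:C)%C.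
Proof.
move=> sA psiN0 e; apply/eigenvalueP; exists (adj psi).
  by rewrite -{1}sA -adjM e adjZ conjc_real.
by rewrite adj_eq0.
Qed.

Lemma unit_neq0 v : vnorm v = 1 -> v != 0.
Proof.
by move=> v1; apply/eqP => v0; have := oner_neq0 R; rewrite -v1 v0 vnorm0 eqxx.
Qed.

Lemma exists_gapped_ground_state A (g : R) : selfadj A -> unique_gs_gap A g ->
  exists psi E, gapped_ground_state A g psi E.
Proof.
move=> sA [E [/eigenvalueP [w we wN0] [rk gap]]].
pose v := adj w.
have vN0 : vnorm v != 0.
  by apply: contra wN0 => /eqP/vnorm_eq0 v0; rewrite -adj_eq0 -/v v0.
have v_gt0 : 0 < vnorm v by rewrite lt_def vN0 vnorm_ge0.
exists (((vnorm v)^-1)%:C%C *: v), E; split=> //.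
- by rewrite vnormZ normc_real ger0_norm ?invr_ge0 ?vnorm_ge0 // mulVf.
- by rewrite -scalemxAr -{1}sA -adjM we adjZ conjc_real scalerA mulrC -scalerA.
Qed.

(** The minimal energy [E] of the projection and the energy [E'] of the gap condition must coincide:
    [E <= E'] by minimality, and the alternative [E' + g <= E] contradicts [0 < g]. *)
Lemma ground_state_proj_gapped A (g : R) rho : selfadj A -> 0 < g ->
  unique_gs_gap A g -> ground_state_proj A rho ->
  exists psi E, gapped_ground_state A g psi E /\ rho = psi *m adj psi.
Proof.
move=> sA g0 [E' [evE' [rk gap]]] [psi [E [psi1 [e [Emin ->]]]]].
exists psi, E; split; last by [].
have evE : eigenvalue A (E%:C)%C by apply: eigenvalue_selfadj e; rewrite ?unit_neq0.
have /Emin := evE'; rewrite lecR => leE.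
have [/complexI eE|] := gap _ evE; first by rewrite eE in e *; split.
by rewrite lecR => h; lra.
Qed.

(** Each diagonal entry is an eigenvalue, with a row of [U] as eigenvector. Its reality comes from
    the gap condition: the order on [R[i]] only compares numbers with equal imaginary parts. *)
Lemma gapped_spectrum A g psi E : selfadj A -> gapped_ground_state A g psi E ->
  exists (U : 'M[R[i]]_n) (d : 'I_n -> R),
    [/\ adj U *m U = 1%:M, U *m adj U = 1%:M,
        A = adj U *m diag_mx (\row_i ((d i)%:C)%C) *m U &
        forall i, d i = E \/ E + g <= d i].
Proof.
move=> sA [_ _ _ gap]; have [U [d [uU Uu eA]]] := selfadj_diagonalizable sA.
have ev i : eigenvalue A (d 0 i).
  apply/eigenvalueP; exists (row i U).
    rewrite {1}eA -row_mul !mulmxA Uu mul1mx.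
    by apply/rowP => j; rewrite mul_diag_mx !mxE.
  apply/eqP => r0; have /matrixP/(_ i i) := Uu.
  rewrite !mxE eqxx /= => /eqP; rewrite big1 ?(eq_sym 0) ?oner_eq0 // => k _.
  by have /rowP/(_ k) := r0; rewrite !mxE => ->; rewrite mul0r.
have dE i : d 0 i = ((complex.Re (d 0 i))%:C)%C.
  have [->//|] := gap _ (ev i); rewrite lecE => /andP[/eqP im _].
  by apply/eqP; rewrite eq_complex /= im !eqxx.
exists U, (fun i => complex.Re (d 0 i)); split=> //.
  rewrite {1}eA; congr (_ *m diag_mx _ *m _); apply/rowP => i.
  by rewrite mxE -dE.
move=> i; have [eE|] := gap _ (ev i); first by left; rewrite eE.
by rewrite lecE => /andP[_ ?]; right.
Qed.

Lemma scalar_mx_conj (U : 'M[R[i]]_n) (x : R[i]) :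
  adj U *m U = 1%:M -> x%:M = adj U *m diag_mx (const_mx x) *m U.
Proof. by move=> uU; rewrite diag_const_mx scalar_mxC -mulmxA uU mulmx1. Qed.

(** The variational principle: in the eigenbasis the quadratic form weighs the squared coordinates
    with eigenvalues that are all at least [E]. *)
Lemma ground_energy_le A g psi E v : selfadj A -> 0 < g ->
  gapped_ground_state A g psi E -> ((E * vnorm v ^+ 2)%:C)%C <= dot v (A *m v).
Proof.
move=> sA g0 gs; have [U [d [uU _ -> dE]]] := gapped_spectrum sA gs.
rewrite -!mulmxA -(adjK U) -dot_adj adjK -(vnorm_isometry v uU).
move: (U *m v) => w; rewrite vnorm_sqr mulr_sumr rmorph_sum dot_sum /=.
apply: ler_sum => i _; rewrite mul_diag_mx !mxE [X in _ <= X]mulrCA -sqr_normcE -rmorphM lecR.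
by rewrite ler_wpM2r ?sqr_ge0 //; have [->//|] := dE i; lra.
Qed.

(** [Q] is the function of [A] with value [(d - E)^-1] on the excited levels and [0] on the ground
    level. The gap bounds all these values by [1 / g], and a simple ground level makes its spectral
    projection the projection onto [psi]. *)
Lemma reduced_resolvent A g psi E : selfadj A -> 0 < g ->
  gapped_ground_state A g psi E ->
  exists Q : 'M[R[i]]_n,
    [/\ (A - (E%:C)%C%:M) *m Q = 1%:M - psi *m adj psi,
        Q *m (A - (E%:C)%C%:M) = 1%:M - psi *m adj psi &
        forall v, vnorm (Q *m v) <= vnorm v / g].
Proof.
move=> sA g0 gs; have [U [d [uU Uu eA dE]]] := gapped_spectrum sA gs.
have [psi1 ePsi rk _] := gs.
pose r i := if d i == E then 0 else (d i - E)^-1.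
pose D (f : 'I_n -> R) := adj U *m diag_mx (\row_i ((f i)%:C)%C) *m U.
have DM f1 f2 : D f1 *m D f2 = D (fun i => f1 i * f2 i).
  rewrite /D -!mulmxA; congr (_ *m _); rewrite !mulmxA -[_ *m U *m _]mulmxA Uu mulmx1.
  by congr (_ *m _); rewrite mulmx_diag; congr diag_mx; apply/rowP => i; rewrite !mxE rmorphM.
have Dad f : adj (D f) = D f.
  rewrite /D !adjM adjK mulmxA; congr (_ *m _ *m _).
  apply/matrixP => i j; rewrite !mxE [j == i]eq_sym; case: eqVneq => [->|_].
    by rewrite !mulr1n conjc_real.
  by rewrite !mulr0n conjc0.
have eh : A - (E%:C)%C%:M = D (fun i => d i - E).
  rewrite (scalar_mx_conj _ uU) eA -mulmxBl -mulmxBr /D; congr (_ *m _ *m _).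
  rewrite -linearB; congr diag_mx; apply/rowP => i; by rewrite !mxE rmorphB.
have e1 : 1%:M = D (fun => 1).
  by rewrite (scalar_mx_conj _ uU) /D; congr (_ *m diag_mx _ *m _); apply/rowP => i; rewrite !mxE.
pose P := D (fun i => (d i == E)%:R).
have DB f1 f2 : D f1 - D f2 = D (fun i => f1 i - f2 i).
  rewrite /D -mulmxBl -mulmxBr -linearB; congr (_ *m diag_mx _ *m _).
  by apply/rowP => i; rewrite !mxE rmorphB.
have Dext f1 f2 : f1 =1 f2 -> D f1 = D f2.
  by move=> ef; rewrite /D; congr (_ *m diag_mx _ *m _); apply/rowP => i; rewrite !mxE ef.
have hr i : (d i - E) * r i = 1 - (d i == E)%:R.
  rewrite /r; case: eqVneq => [->|ne]; first by rewrite mulr0 subrr.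
  by rewrite divff ?subr0 // subr_eq0.
have hQ : (A - (E%:C)%C%:M) *m D r = 1%:M - P.
  by rewrite eh DM e1 DB; apply: Dext.
have Qh : D r *m (A - (E%:C)%C%:M) = 1%:M - P.
  by rewrite eh DM e1 DB; apply: Dext => i /=; rewrite mulrC.
have Ph : P *m (A - (E%:C)%C%:M) = 0.
  rewrite eh DM (Dext _ (fun => 0)).
    rewrite /D (_ : \row__ _ = 0) ?linear0 ?mulmx0 ?mul0mx //.
    by apply/rowP => i; rewrite !mxE.
  by move=> i; case: eqVneq => [->|_]; rewrite ?mul0r // subrr mulr0.
have hpsi : (A - (E%:C)%C%:M) *m psi = 0 by rewrite mulmxBl ePsi mul_scalar_mx subrr.
have Ppsi : P *m psi = psi.
  have -> : P = 1%:M - D r *m (A - (E%:C)%C%:M) by rewrite Qh subKr.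
  by rewrite mulmxBl -mulmxA hpsi mulmx0 subr0 mul1mx.
(* The rows of [P] are left eigenvectors for [E], and that eigenspace is the line of [adj psi].
   Hence [P = w *m adj psi] for some [w], and [P *m psi = psi] forces [w = psi]. *)
have sub_psi : (adj psi <= eigenspace A (E%:C)%C)%MS.
  by apply/eigenspaceP; rewrite -{1}sA -adjM ePsi adjZ conjc_real.
have psiN0 : adj psi != 0. by rewrite adj_eq0 unit_neq0.
have eig_sub : (eigenspace A (E%:C)%C <= adj psi)%MS.
  by rewrite -(mxrank_leqif_sup sub_psi) rk rank_rV psiN0.
have /submxP[w ew] : (P <= adj psi)%MS.
  by apply: submx_trans eig_sub; apply/sub_kermxP.
have wpsi : w = psi.
  rewrite -[RHS]Ppsi ew -mulmxA.
  have -> : adj psi *m psi = 1%:M; last by rewrite mulmx1.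
  apply/matrixP => i j; rewrite !ord1 -[LHS]/(dot psi psi) dot_vnorm psi1 mxE eqxx.
  by rewrite expr1n.
have eP : P = psi *m adj psi by rewrite ew wpsi.
rewrite eP in hQ Qh; exists (D r); split; [exact: hQ|exact: Qh|move=> v].
have uU' : adj (adj U) *m adj U = 1%:M by rewrite adjK.
rewrite /D -!mulmxA vnorm_isometry // -(vnorm_isometry v uU).
move: (U *m v) => u; rewrite ler_pdivlMr //.
rewrite -(@ler_pXn2r _ 2) ?nnegrE ?mulr_ge0 ?vnorm_ge0 ?(ltW g0) //.
rewrite exprMn !vnorm_sqr mulr_suml; apply: ler_sum => i _.
rewrite mul_diag_mx !mxE ComplexField.Normc.normcM exprMn mulrAC.
rewrite ler_piMl ?sqr_ge0 // -exprMn normc_real exprn_ile1 ?mulr_ge0 ?(ltW g0) //.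
rewrite /r; case: eqVneq => [_|ne]; first by rewrite normr0 mul0r.
have [e|le] := dE i; first by rewrite e eqxx in ne.
have dgt : 0 < d i - E by lra.
by rewrite ger0_norm ?invr_ge0 ?(ltW dgt) // ler_pdivrMl // mulr1; lra.
Qed.

End Spectral.

(** * Change of ground-state expectations along a gapped path *)

Section Perturbation.
Variables (R : realType) (n : nat).
Implicit Types (A B C D : 'M[R[i]]_n) (psi phi chi v w : 'cV[R[i]]_n).

Definition orth_part psi phi := phi - dot psi phi *: psi.

Lemma dot_unit psi : vnorm psi = 1 -> dot psi psi = 1.
Proof. by move=> p1; rewrite dot_vnorm p1 expr1n. Qed.

Lemma outer_mul psi v : psi *m adj psi *m v = dot psi v *: psi.
Proof.
rewrite -mulmxA (_ : adj psi *m v = (dot psi v)%:M) ?mul_mx_scalar //.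
by apply/matrixP => i j; rewrite !ord1 [RHS]mxE mulr1n.
Qed.

Lemma orth_partE psi phi : orth_part psi phi = (1%:M - psi *m adj psi) *m phi.
Proof. by rewrite mulmxBl mul1mx outer_mul. Qed.

Lemma dot_orth_part psi phi : vnorm psi = 1 -> dot psi (orth_part psi phi) = 0.
Proof. by move=> p1; rewrite dotBr dotZr dot_unit // mulr1 subrr. Qed.

Lemma vnorm_orth_part psi phi : vnorm psi = 1 ->
  vnorm phi ^+ 2 = normc (dot psi phi) ^+ 2 + vnorm (orth_part psi phi) ^+ 2.
Proof.
move=> p1; apply: complexI; rewrite rmorphD /= sqr_normcE -!dot_vnorm.
rewrite {2}/orth_part dotBl dotBr !dotZr dotZl dot_orth_part // mulr0 subr0.
by rewrite -[dot phi psi]dot_conj; ring.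
Qed.

(* Expand [phi = a psi + chi], with [1 - |a|^2 = |chi|^2]: only the two cross terms are of first order in [chi]. *)
Lemma expectation_diff psi phi B (k : R) : vnorm psi = 1 -> vnorm phi = 1 ->
  normc (conjc (dot psi phi) * dot psi (B *m orth_part psi phi)) <= k ->
  normc (dot psi phi * dot (orth_part psi phi) (B *m psi)) <= k ->
  normc (dot phi (B *m phi) - dot psi (B *m psi))
    <= 2 * k + 2 * opnorm B * vnorm (orth_part psi phi) ^+ 2.
Proof.
move=> psi1 phi1; set a := dot psi phi; set chi := orth_part psi phi => h1 h2.
have ephi : phi = a *: psi + chi by rewrite addrC subrK.
have ea : conjc a * a = 1 - ((vnorm chi ^+ 2)%:C)%C.
  rewrite -sqr_normcE -[X in X - _]/(((1 : R)%:C)%C) -rmorphB; congr (_%:C)%C.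
  by have := vnorm_orth_part phi psi1; rewrite phi1 expr1n -/chi -/a; lra.
have -> : dot phi (B *m phi) - dot psi (B *m psi) =
  (conjc a * dot psi (B *m chi) + a * dot chi (B *m psi)) +
  (dot chi (B *m chi) - ((vnorm chi ^+ 2)%:C)%C * dot psi (B *m psi)).
  rewrite {1 2}ephi mulmxDr -scalemxAr dotDl !dotDr !dotZl !dotZr.
  by rewrite mulrA ea; ring.
have b1 := dot_mul_le B chi chi; have b2 := dot_mul_le B psi psi.
have B0 := opnorm_ge0 B.
apply: (le_trans (le_normcD _ _)); apply: lerD.
  by apply: (le_trans (le_normcD _ _)); lra.


apply: (le_trans (le_normcD _ _)).
rewrite normcN ComplexField.Normc.normcM normc_real.
rewrite (ger0_norm (sqr_ge0 _)).
have := ler_wpM2l (sqr_ge0 (vnorm chi)) b2; rewrite psi1; nra.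
Qed.

(** The orthogonal part is the reduced resolvent applied to [(A - E) phi]. *)
Lemma orth_part_gap A g psi E phi : selfadj A -> 0 < g ->
  gapped_ground_state A g psi E ->
  vnorm (orth_part psi phi) <= vnorm ((A - (E%:C)%C%:M) *m phi) / g.
Proof.
move=> sA g0 /(reduced_resolvent sA g0)[Q [_ Qh Qn]].
by rewrite orth_partE -Qh -mulmxA.
Qed.

(** The eigenvector [phi] of [A + D] serves as a trial state for [A]. *)
Lemma ground_energy_perturb A D g psi E phi E' (eps : R) :
  selfadj A -> 0 < g -> gapped_ground_state A g psi E ->
  vnorm phi = 1 -> (A + D) *m phi = (E'%:C)%C *: phi ->
  (forall v, vnorm (D *m v) <= eps * vnorm v) -> E <= E' + eps.
Proof.
move=> sA g0 gs phi1 ephi hD.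
have := ground_energy_le phi sA g0 gs.
have -> : A *m phi = (E'%:C)%C *: phi - D *m phi by rewrite -ephi mulmxDl addrK.
rewrite dotBr dotZr dot_unit // phi1 expr1n !mulr1 lecE => /andP[_ /=].
have : - complex.Re (dot phi (D *m phi)) <= eps.
  rewrite (_ : - _ = complex.Re (- dot phi (D *m phi))); last by case: (dot _ _).
  rewrite -[- dot _ _]add0r -[X in X - _](dot0r phi) -dotBr sub0r; apply: le_trans (Re_le_normc _) _.
  apply: (le_trans (cauchy_schwarz _ _)); rewrite phi1 mul1r vnormN.
  by rewrite (le_trans (hD _)) // phi1 mulr1.
by case: (dot phi (D *m phi)) => x y /=; lra.
Qed.

(** Each ground state is a trial state for the other matrix, so [|E' - E| <= eps]. Then [(A - E) phi
    = (E' - E) phi - (A' - A) phi] has norm at most [2 * eps], one [eps] from the energy shift and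
    one from the perturbation. *)
Lemma orth_part_perturb A A' g psi E phi E' (eps : R) :
  selfadj A -> selfadj A' -> 0 < g ->
  gapped_ground_state A g psi E -> gapped_ground_state A' g phi E' ->
  (forall v, vnorm ((A' - A) *m v) <= eps * vnorm v) ->
  vnorm (orth_part psi phi) <= 2 * eps / g.
Proof.
move=> sA sA' g0 gs gs' hD.
have [psi1 epsi _ _] := gs; have [phi1 ephi _ _] := gs'.
have le1 : E <= E' + eps.
  by apply: (ground_energy_perturb sA g0 gs phi1 _ hD); rewrite addrC subrK.
have le2 : E' <= E + eps.
  apply: (ground_energy_perturb (D := A - A') sA' g0 gs' psi1) => [|v].
    by rewrite addrC subrK.
  by rewrite -opprB mulNmx vnormN.
apply: (le_trans (orth_part_gap phi sA g0 gs)).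
rewrite ler_wpM2r ?invr_ge0 ?(ltW g0) //.
have -> : (A - (E%:C)%C%:M) *m phi = ((E' - E)%:C)%C *: phi - (A' - A) *m phi.
  by rewrite !mulmxBl ephi mul_scalar_mx rmorphB scalerBl opprB [RHS]addrC addrA addrNK.
apply: (le_trans (vnormB _ _)); rewrite vnormZ normc_real phi1 mulr1.
have := hD phi; rewrite phi1 mulr1 => h.
have : `|E' - E| <= eps by rewrite ler_norml; apply/andP; split; lra.
lra.
Qed.

Lemma commute_sub_scalar A C (a : R[i]) : A *m C = C *m A ->
  (A - a%:M) *m C = C *m (A - a%:M).
Proof. by move=> comAC; rewrite mulmxBl mulmxBr comAC mul_scalar_mx mul_mx_scalar. Qed.

(** By commutation [C *m psi] stays in the kernel of [A - E], which is the line of [psi];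
    self-adjointness of [C] makes the factor real. *)
Lemma ground_state_commute A C g psi E : selfadj A -> selfadj C -> 0 < g ->
  gapped_ground_state A g psi E -> A *m C = C *m A ->
  exists c : R, C *m psi = (c%:C)%C *: psi.
Proof.
move=> sA sC g0 gs comAC; have [psi1 epsi _ _] := gs.
have [Q [_ Qh _]] := reduced_resolvent sA g0 gs.
have : (1%:M - psi *m adj psi) *m (C *m psi) = 0.
  rewrite -Qh -mulmxA (mulmxA _ C) (commute_sub_scalar _ comAC) -(mulmxA C).
  by rewrite mulmxBl epsi mul_scalar_mx subrr !mulmx0.
rewrite -orth_partE => /eqP; rewrite subr_eq0 => /eqP e.
exists (complex.Re (dot psi (C *m psi))); rewrite {1}e; congr (_ *: _).
have := dot_conj psi (C *m psi); rewrite dot_selfadj //.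
case: (dot _ _) => x y [] y0; apply/eqP; rewrite eq_complex /= eqxx /=.
by apply/eqP; lra.
Qed.

(* On the eigenspace [C = c] of [psi], [h = A - E] acts as [(A - C) - (E - c)].
   Since [chi = h w] with [w] in that eigenspace ([w] is the reduced resolvent
   applied to [chi]), [<psi, B chi> = <psi, [B, A - C] w>]. *)
Lemma ground_state_offdiag A C B g psi E (c k : R) chi :
  selfadj A -> selfadj C -> 0 < g ->
  gapped_ground_state A g psi E -> A *m C = C *m A ->
  C *m psi = (c%:C)%C *: psi -> C *m chi = (c%:C)%C *: chi ->
  dot psi chi = 0 ->
  (forall v, vnorm (((A - C) *m B - B *m (A - C)) *m v) <= k * vnorm v) ->
  normc (dot psi (B *m chi)) <= k * (vnorm chi / g)
  /\ normc (dot chi (B *m psi)) <= k * (vnorm chi / g).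
Proof.
move=> sA sC g0 gs comAC Cpsi Cchi psichi hk; have [psi1 epsi _ _] := gs.
have [Q [hQ Qh Qn]] := reduced_resolvent sA g0 gs.
set h := A - _ in hQ Qh.
pose w := Q *m chi - dot psi (Q *m chi) *: psi.
have hpsi : h *m psi = 0 by rewrite mulmxBl epsi mul_scalar_mx subrr.
have hw : h *m w = chi.
  rewrite mulmxBr -scalemxAr hpsi scaler0 subr0 mulmxA hQ -orth_partE.
  by rewrite /orth_part psichi scale0r subr0.
have psiw : dot psi w = 0 by apply: dot_orth_part.
have nw : vnorm w <= vnorm chi / g.
  rewrite (_ : w = Q *m (h *m w)); last first.
    by rewrite mulmxA Qh -orth_partE /orth_part psiw scale0r subr0.
  by rewrite hw.
have Cw : C *m w = (c%:C)%C *: w.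
  (* The defect [z] is killed by [h], hence a multiple of [psi]; it is also orthogonal to [psi],
     hence zero. *)
  pose z := C *m w - (c%:C)%C *: w.
  have hz : h *m z = 0.
    rewrite mulmxBr -scalemxAr hw mulmxA (commute_sub_scalar _ comAC).
    by rewrite -(mulmxA C) hw Cchi subrr.
  have : (1%:M - psi *m adj psi) *m z = 0 by rewrite -Qh -mulmxA hz mulmx0.
  rewrite -orth_partE /orth_part dotBr dotZr psiw mulr0 subr0 -dot_selfadj //.
  by rewrite Cpsi dotZl psiw mulr0 scale0r subr0 => /eqP; rewrite subr_eq0 => /eqP.
pose M := A - C; pose m := E - c.
have Mw : chi = M *m w - (m%:C)%C *: w.
  rewrite -[LHS]hw /h /M !mulmxBl Cw mul_scalar_mx rmorphB scalerBl.
  by rewrite opprB addrA addrNK.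
have Mpsi : M *m psi = (m%:C)%C *: psi by rewrite mulmxBl epsi Cpsi -scalerBl -rmorphB.
have sM : selfadj M by rewrite /selfadj adjB sA sC.
rewrite -/M in hk; clearbody M w.
split.
- have -> : dot psi (B *m chi) = dot psi (- ((M *m B - B *m M) *m w)).
    rewrite Mw mulmxBr -scalemxAr mulmxBl -!mulmxA opprB !dotBr dotZr.
    by rewrite -(dot_selfadj _ _ sM) Mpsi dotZl conjc_real.
  apply: (le_trans (cauchy_schwarz _ _)); rewrite psi1 mul1r vnormN.
  apply: (le_trans (hk _)); rewrite ler_wpM2l //.
  by have := le_trans (vnorm_ge0 _) (hk psi); rewrite psi1 mulr1.
- have -> : dot chi (B *m psi) = dot w ((M *m B - B *m M) *m psi).
    rewrite {1}Mw dotBl dotZl conjc_real mulmxBl -!mulmxA Mpsi -scalemxAr dotBr dotZr.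
    by rewrite dot_selfadj.
  apply: (le_trans (cauchy_schwarz _ _)); rewrite mulrC.
  have := hk psi; rewrite psi1 mulr1 => hk'.
  by apply: ler_pM; rewrite ?vnorm_ge0.
Qed.

(** One step of the path: the first term is linear in the distance of the two ground states and
    carries the commutator constant [k]; the second is quadratic and disappears as the steps
    shrink. *)
Lemma expectation_step A A' B C g psi E phi E' (k : R) :
  selfadj A -> selfadj A' -> selfadj C -> 0 < g ->
  gapped_ground_state A g psi E -> gapped_ground_state A' g phi E' ->
  A *m C = C *m A -> A' *m C = C *m A' ->
  (forall v, vnorm (((A - C) *m B - B *m (A - C)) *m v) <= k * vnorm v) ->
  normc (dot phi (B *m phi) - dot psi (B *m psi))
    <= 2 * (k * (vnorm (orth_part psi phi) / g))
       + 2 * opnorm B * vnorm (orth_part psi phi) ^+ 2.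
Proof.
move=> sA sA' sC g0 gs gs' comAC comA'C hk.
have [psi1 _ _ _] := gs; have [phi1 _ _ _] := gs'.
have [c Cpsi] := ground_state_commute sA sC g0 gs comAC.
have [c' Cphi] := ground_state_commute sA' sC g0 gs' comA'C.
have k0 : 0 <= k by have := le_trans (vnorm_ge0 _) (hk psi); rewrite psi1 mulr1.
have b0 : 0 <= k * (vnorm (orth_part psi phi) / g).
  by rewrite mulr_ge0 ?divr_ge0 ?vnorm_ge0 ?(ltW g0).
(* For orthogonal ground states the eigenvalues of [C] may differ, but both cross terms carry the
   overlap as a factor and vanish. *)
have [a0|aN0] := eqVneq (dot psi phi) 0.
  by apply: expectation_diff; rewrite // a0 ?conjc0 mul0r ComplexField.Normc.normc0.
have ecc : c = c'.
  have := dot_selfadj psi phi sC; rewrite Cpsi Cphi dotZl dotZr conjc_real.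
  by move/(mulIf aN0)/complexI.
have Cchi : C *m orth_part psi phi = (c%:C)%C *: orth_part psi phi.
  by rewrite mulmxBr Cphi -scalemxAr Cpsi scalerBr -ecc !scalerA mulrC.
have [h1 h2] := ground_state_offdiag sA sC g0 gs comAC Cpsi Cchi (dot_orth_part _ psi1) hk.
have a1 : normc (dot psi phi) <= 1.
  by rewrite (le_trans (cauchy_schwarz _ _)) // psi1 phi1 mulr1.
have pos := normc_ge0.
apply: expectation_diff => //; rewrite ComplexField.Normc.normcM ?normc_conjc.
  by apply: le_trans h1; rewrite ler_piMl.
by apply: le_trans h2; rewrite ler_piMl.
Qed.

Lemma trace_outer psi B : \tr (psi *m adj psi *m B) = dot psi (B *m psi).
Proof. by rewrite -mulmxA mxtrace_mulC -mulmxA /mxtrace big_ord1. Qed.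

Lemma ler_archi (x y z : R) : (forall N : nat, x <= y + z / N.+1%:R) -> x <= y.
Proof.
move=> h; apply/ler_addgt0Pr => e e0.
have hN := @archi_boundP R (`|z| / e) (divr_ge0 (normr_ge0 _) (ltW e0)).
set N := Num.bound _ in hN.
apply: (le_trans (h N)); rewrite lerD2l ler_pdivrMr ?ltr0Sn //.
apply: (le_trans (ler_norm z)); rewrite mulrC -ler_pdivrMr //.
by rewrite (le_trans (ltW hN)) // ler_nat.
Qed.

(* Walking from [0] to [1] in [N] steps, the second-order errors add up to
   [O(1/N)]; this replaces differentiating the ground state in [lam]. *)
Lemma expectation_perturb_bound (A V B C rho0 rho1 : 'M[R[i]]_n) (g k : R) :
  selfadj A -> selfadj V -> selfadj C -> 0 < g -> 0 <= k ->
  (forall lam : R, 0 <= lam <= 1 -> unique_gs_gap (A + (lam%:C)%C *: V) g) ->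
  A *m C = C *m A -> V *m C = C *m V ->
  (forall lam : R, 0 <= lam <= 1 -> forall v,
     vnorm (((A + (lam%:C)%C *: V - C) *m B - B *m (A + (lam%:C)%C *: V - C)) *m v)
       <= k * vnorm v) ->
  ground_state_proj A rho0 -> ground_state_proj (A + V) rho1 ->
  normc (\tr (rho0 *m B) - \tr (rho1 *m B)) <= 4 * k * opnorm V / g ^+ 2.
Proof.
move=> sA sV sC g0 k0 gap comAC comVC hk gs0 gs1.
pose H (lam : R) := A + (lam%:C)%C *: V.
have sH lam : selfadj (H lam) by rewrite /selfadj adjD adjZ conjc_real sA sV.
have comHC lam : H lam *m C = C *m H lam.
  by rewrite mulmxDl mulmxDr comAC -scalemxAl comVC scalemxAr.
have H0 : A = H 0 by rewrite /H scale0r addr0.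
have H1 : A + V = H 1 by rewrite /H scale1r.
rewrite H0 in gs0; rewrite H1 in gs1.
have gap0 : unique_gs_gap (H 0) g by apply: gap; rewrite lexx ler01.
have [psi0 [E0 [g_psi0 ->]]] := ground_state_proj_gapped (sH 0) g0 gap0 gs0.
have gap1 : unique_gs_gap (H 1) g by apply: gap; rewrite lexx ler01.
have [psi1 [E1 [g_psi1 ->]]] := ground_state_proj_gapped (sH 1) g0 gap1 gs1.
rewrite !trace_outer -normcN opprB.
(* The quadratic term of one of the [N.+1] steps is [2 * opnorm B * x ^+ 2] with [x] as below; the
   [N.+1] of them add up to this constant divided by [N.+1]. *)
apply: (ler_archi (z := 8 * opnorm B * opnorm V ^+ 2 / g ^+ 2)) => N.
pose M : R := N.+1%:R.
have M0 : 0 < M by rewrite ltr0Sn.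
pose x := 2 * (opnorm V / M) / g.
pose s := 2 * (k * (x / g)) + 2 * opnorm B * x ^+ 2.
have step (j : nat) phi phi' E E' : (j < N.+1)%N ->
    gapped_ground_state (H (j%:R / M)) g phi E ->
    gapped_ground_state (H (j.+1%:R / M)) g phi' E' ->
    normc (dot phi' (B *m phi') - dot phi (B *m phi)) <= s.
  move=> jN g_phi g_phi'.
  have j01 : 0 <= j%:R / M <= 1.
    rewrite divr_ge0 ?(ltW M0) //= ler_pdivrMr // mul1r ler_nat ltnW //.
  have hx : vnorm (orth_part phi phi') <= x.
    apply: (orth_part_perturb (sH _) (sH _) g0 g_phi g_phi') => v.
    rewrite opprD addrACA subrr add0r -scalerBl -rmorphB -scalemxAl vnormZ normc_real.
    rewrite -mulrBl -natrB // subSnn mul1r ger0_norm ?invr_ge0 ?(ltW M0) //.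
    by rewrite mulrAC mulrC ler_wpM2r ?invr_ge0 ?(ltW M0) ?vnorm_mul_le.
  apply: (le_trans (expectation_step (sH _) (sH _) sC g0 g_phi g_phi'
    (comHC _) (comHC _) (hk _ j01))).
  have x0 := le_trans (vnorm_ge0 _) hx.
  rewrite lerD // ?ler_wpM2l ?mulr_ge0 ?opnorm_ge0 ?ler_wpM2r ?invr_ge0 ?(ltW g0) //.
  by rewrite ler_pXn2r ?nnegrE ?vnorm_ge0.
have walk (j : nat) : (j < N.+1)%N -> forall phi E,
    gapped_ground_state (H (j.+1%:R / M)) g phi E ->
    normc (dot phi (B *m phi) - dot psi0 (B *m psi0)) <= j.+1%:R * s.
  elim: j => [|j IH] jN phi E g_phi.
    have h0 : gapped_ground_state (H (0%:R / M)) g psi0 E0.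
      rewrite mul0r.
      exact: g_psi0.
    rewrite mul1r.
    exact: (step 0%N psi0 phi E0 E jN h0 g_phi).
  have j01 : 0 <= j.+1%:R / M <= 1.
    by rewrite divr_ge0 ?(ltW M0) //= ler_pdivrMr // mul1r ler_nat ltnW.
  (* Any unit ground vector will do at the intermediate points: only expectations are compared, so
     phases need not be matched. *)
  have [chi [E' g_chi]] := exists_gapped_ground_state (sH _) (gap _ j01).
  have h1 := IH (ltnW jN) _ _ g_chi; have h2 := step j.+1 chi phi E' E jN g_chi g_phi.
  rewrite -(subrKA (dot chi (B *m chi))); apply: (le_trans (le_normcD _ _)).
  by rewrite -natr1 mulrDl mul1r addrC lerD.
have := walk N (ltnSn N) psi1 E1; rewrite -/M divff ?gt_eqF // => /(_ g_psi1) h.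
apply: (le_trans h); rewrite le_eqVlt; apply/orP; left; apply/eqP.
have sumE (b v m : R) : m != 0 -> m * (2 * (k * (2 * (v / m) / g / g)) +
    2 * b * (2 * (v / m) / g) ^+ 2) = 4 * k * v / g ^+ 2 + 8 * b * v ^+ 2 / g ^+ 2 / m.
  by move=> m0; field; rewrite m0 gt_eqF.
by apply: sumE; rewrite gt_eqF.
Qed.

End Perturbation.

(** * Supports of observables and single-spin flips *)

Section Locality.
Variables (R : realType) (T : finType) (q : nat).
Implicit Types (A B : obs R T q) (X Y Z : {set T}) (s t u : conf T q) (x : T).

Lemma entry_mul A B s t : entry (A *m B) s t = \sum_u entry A s u * entry B u t.
Proof.
rewrite /entry mxE (reindex enum_rank) //=.
by apply: onW_bij; apply: enum_rank_bij.
Qed.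

Lemma entry_inj A B : (forall s t, entry A s t = entry B s t) -> A = B.
Proof.
by move=> h; apply/matrixP => i j; have := h (enum_val i) (enum_val j); rewrite /entry !enum_valK.
Qed.

Lemma agree_onP Z s t : reflect (forall x, x \in Z -> s x = t x) (agree_on Z s t).
Proof.
apply: (iffP forallP) => h x; first by move=> xZ; have := h x; rewrite xZ => /eqP.
by apply/implyP => /h/eqP.
Qed.

(** Only one intermediate configuration contributes to the product: it equals [t] on [Z] and [s]
    elsewhere. The resulting entry is symmetric in the two factors, which gives commutation for
    disjoint supports. *)
Lemma entry_mul_disjoint A A' Z Z' (a a' : conf T q -> conf T q -> R[i]) :
  [disjoint Z & Z'] ->
  (forall s s' t t', agree_on Z s s' -> agree_on Z t t' -> a s t = a s' t') ->
  (forall s s' t t', agree_on Z' s s' -> agree_on Z' t t' -> a' s t = a' s' t') ->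
  (forall s t, entry A s t = (if agree_on (~: Z) s t then a s t else 0)) ->
  (forall s t, entry A' s t = (if agree_on (~: Z') s t then a' s t else 0)) ->
  forall s t, entry (A *m A') s t =
    (if agree_on (~: (Z :|: Z')) s t then a s t * a' s t else 0).
Proof.
move=> dZ ha ha' eA eA' s t; rewrite entry_mul.
pose u0 : conf T q := [ffun x => if x \in Z then t x else s x].
have agree_refl W (r : conf T q) : agree_on W r r by apply/agree_onP.
rewrite (bigD1 u0) //= big1 ?addr0 => [|u uN].
  rewrite eA eA'.
  have -> : agree_on (~: Z) s u0.
    by apply/agree_onP => x; rewrite inE ffunE => /negbTE ->.
  have -> : agree_on (~: Z') u0 t = agree_on (~: (Z :|: Z')) s t.
    apply/agree_onP/agree_onP => h x; rewrite !inE ?negb_or ?ffunE.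
      by move=> /andP[xZ xZ']; have := h x; rewrite inE ffunE xZ' (negbTE xZ) => ->.
    by case: ifP => // xZ xZ'; apply: h; rewrite !inE xZ.
  case: ifP => _; last by rewrite mulr0.
  congr (_ * _); [apply: ha|apply: ha'] => //; apply/agree_onP => x; rewrite ffunE.
    by move=> ->.
  by move=> xZ'; rewrite (disjointFl dZ xZ').
rewrite eA eA'; case: ifP => [/agree_onP h1|]; last by rewrite mul0r.
case: ifP => [/agree_onP h2|]; last by rewrite mulr0.
case/eqP: uN; apply/ffunP => x; rewrite ffunE; case: ifP => xZ.
  by apply: h2; rewrite inE (disjointFr dZ xZ).
by rewrite -h1 // inE xZ.
Qed.

Lemma supported_comm A A' Z Z' : supported Z A -> supported Z' A' ->
  [disjoint Z & Z'] -> A *m A' = A' *m A.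
Proof.
move=> [a [ha eA]] [a' [ha' eA']] dZ; apply: entry_inj => s t.
have dZ' : [disjoint Z' & Z] by rewrite disjoint_sym.
rewrite (entry_mul_disjoint dZ ha ha' eA eA') (entry_mul_disjoint dZ' ha' ha eA' eA).
by rewrite finset.setUC mulrC.
Qed.

(** There is at most one configuration, so every observable is supported on the empty set. *)
Lemma small_spin_comm A B : (q <= 1)%N -> A *m B = B *m A.
Proof.
move=> q1; have conf1 s t : s = t.
  apply/ffunP => x; apply: ord_inj.
  by case: (s x) (t x) => [i hi] [j hj] /=; lia.
have sup (D : obs R T q) : supported finset.set0 D.
  exists (entry D); split => [s s' t t' _ _|s t].
    by rewrite (conf1 s s') (conf1 t t').
  by case: ifP => // /agree_onP[] x _; rewrite (conf1 s t).
by apply: (@supported_comm _ _ finset.set0 finset.set0) => //; rewrite -finset.setI_eq0 finset.set0I.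
Qed.

(** The matrix unit sending the basis state [a] at [x] to [b], tensored with the identity on the
    other sites. *)
Definition site_flip x (a b : 'I_q) : obs R T q :=
  \matrix_(i, j) (if agree_on (~: [set x]) (enum_val i) (enum_val j)
                  then ((enum_val i x == b) && (enum_val j x == a))%:R else 0).

Lemma supported_site_flip x a b : supported [set x] (site_flip x a b).
Proof.
exists (fun s t => ((s x == b) && (t x == a))%:R); split=> [s s' t t' hs ht|s t].
  by rewrite (agree_onP _ _ _ hs) ?(agree_onP _ _ _ ht) ?inE.
by rewrite /entry mxE !enum_rankK.
Qed.

(** The image has coefficient zero at [s], because [s] has spin [a] at [x], so the eigenvalue would
    be zero; but at the flipped configuration the image has the nonzero coefficient of [psi] at
    [s]. *)
Lemma site_flip_not_eigen x a b (psi : 'cV[R[i]]_(dimH T q)) (s : conf T q) (c : R[i]) :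
  s x = a -> a != b -> psi (enum_rank s) 0 != 0 -> site_flip x a b *m psi <> c *: psi.
Proof.
move=> sx ab ps e.
have c0 : c = 0.
  have /matrixP/(_ (enum_rank s) 0) := e; rewrite !mxE big1 => [/esym/eqP|j _].
    by rewrite mulf_eq0 (negbTE ps) orbF => /eqP.
  by rewrite mxE enum_rankK sx (negbTE ab) /=; case: ifP => _; rewrite mul0r.
pose s' : conf T q := [ffun y => if y == x then b else s y].
have /matrixP/(_ (enum_rank s') 0) := e; rewrite c0 scale0r !mxE.
rewrite (bigD1 (enum_rank s)) //= big1 ?addr0 => [|j jN].
  rewrite mxE !enum_rankK ffunE eqxx sx !eqxx /= ifT ?mul1r; last first.
    by apply/agree_onP => y; rewrite !inE ffunE => /negbTE ->.
  by move/eqP; rewrite (negbTE ps).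
rewrite mxE enum_rankK; case: ifP => [/agree_onP h|]; last by rewrite mul0r.
case: (enum_val j x =P a) => [jx|]; last by rewrite andbF mul0r.
case/eqP: jN; rewrite -[LHS]enum_valK; congr enum_rank; apply/ffunP => y.
have [->|yx] := eqVneq y x; first by rewrite jx sx.
by rewrite -h ?inE // ffunE (negbTE yx).
Qed.

End Locality.

(** * An upper bound on the gap, and norms of commutators *)

Section GapBound.
Variables (R : realType) (n : nat).
Implicit Types (K G F : 'M[R[i]]_n).

(** Let [chi] be the part of [F *m psi] orthogonal to [psi], nonzero by assumption. As [F] commutes
    with [G], it lies in the eigenspace of [G] that contains [psi]. There [K + G - E] acts as
    [K - (E - c)], of norm at most [2 * opnorm K] since [E - c] is an eigenvalue of [K], while the
    gap stretches [chi] by at least [g]. *)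
Lemma gap_le_opnorm K G F (g : R) psi E : selfadj K -> selfadj G -> 0 < g ->
  gapped_ground_state (K + G) g psi E -> K *m G = G *m K -> F *m G = G *m F ->
  (forall c, F *m psi <> c *: psi) -> g <= 2 * opnorm K.
Proof.
move=> sK sG g0 gs comKG comFG hF; have [psi1 epsi _ _] := gs.
have sKG : selfadj (K + G) by rewrite /selfadj adjD sK sG.
have comG : (K + G) *m G = G *m (K + G) by rewrite mulmxDl mulmxDr comKG.
have [c Gpsi] := ground_state_commute sKG sG g0 gs comG.
pose chi := orth_part psi (F *m psi).
have chi0 : 0 < vnorm chi.
  rewrite lt_def vnorm_ge0 andbT; apply/eqP => /vnorm_eq0/eqP.
  by rewrite subr_eq0 => /eqP/hF.
have Gchi : G *m chi = (c%:C)%C *: chi.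
  rewrite mulmxBr mulmxA -comFG -mulmxA Gpsi -!scalemxAr Gpsi scalerBr.
  by rewrite !scalerA mulrC.
have Kpsi : K *m psi = ((E - c)%:C)%C *: psi.
  by rewrite rmorphB scalerBl -epsi -Gpsi mulmxDl addrK.
have hm : `|E - c| <= opnorm K.
  by rewrite -normc_real -[normc _]mulr1 -psi1 -vnormZ -Kpsi -[X in _ <= X]mulr1 -psi1 vnorm_mul_le.
have := orth_part_gap chi sKG g0 gs.
rewrite {1}/orth_part dot_orth_part // scale0r subr0 ler_pdivlMr //.
have -> : (K + G - (E%:C)%C%:M) *m chi = K *m chi - ((E - c)%:C)%C *: chi.
  by rewrite mulmxBl mulmxDl Gchi mul_scalar_mx rmorphB scalerBl opprB addrA.
move=> h; have := le_trans h (vnormB _ _); rewrite vnormZ normc_real.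
have := vnorm_mul_le K chi; have := ler_wpM2r (ltW chi0) hm; nra.
Qed.

Lemma commutator_le (D B : 'M[R[i]]_n) (d : R) v : opnorm D <= d ->
  vnorm ((D *m B - B *m D) *m v) <= 2 * d * opnorm B * vnorm v.
Proof.
move=> hd; rewrite mulmxBl -!mulmxA; apply: (le_trans (vnormB _ _)).
have b0 := opnorm_ge0 B; have v0 := vnorm_ge0 v.
have h1 : vnorm (D *m (B *m v)) <= d * (opnorm B * vnorm v).
  apply: (le_trans (vnorm_mul_le _ _)).
  by rewrite ler_pM ?opnorm_ge0 ?vnorm_ge0 ?vnorm_mul_le.
have h2 : vnorm (B *m (D *m v)) <= opnorm B * (d * vnorm v).
  apply: (le_trans (vnorm_mul_le _ _)); rewrite ler_wpM2l //.
  by apply: (le_trans (vnorm_mul_le _ _)); rewrite ler_wpM2r.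
have -> : 2 * d * opnorm B * vnorm v = d * (opnorm B * vnorm v) + opnorm B * (d * vnorm v).
  by ring.
exact: lerD.
Qed.

End GapBound.

(** * Comparison with the factor [(g + 2) / g ^+ 3] *)

Section BoundArithmetic.
Variables (R : realType) (g N b v : R).
Hypotheses (g0 : 0 < g) (N0 : 0 <= N) (b0 : 0 <= b) (v0 : 0 <= v).

Lemma bound_disjoint :
  4 * (2 * N * b) * v / g ^+ 2 <= 8 * N * b * (v + v ^+ 2) * ((g + 2) / g ^+ 3).
Proof.
rewrite -subr_ge0.
have -> : 8 * N * b * (v + v ^+ 2) * ((g + 2) / g ^+ 3) - 4 * (2 * N * b) * v / g ^+ 2
  = 8 * (N * b * v ^+ 2 / g ^+ 2) + 16 * (N * b * (v + v ^+ 2) / g ^+ 3).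
  by field; rewrite gt_eqF.
by rewrite addr_ge0 // mulr_ge0 // !mulr_ge0 ?addr_ge0 ?exprn_ge0 ?invr_ge0 ?exprn_ge0 // ltW.
Qed.

Lemma commutator_bound_ge0 (d : R) : 0 <= d -> 0 <= 2 * d * b.
Proof. by move=> d0; rewrite !mulr_ge0. Qed.

Lemma derivative_bound_ge0 : 0 <= 4 * (2 * N * b) * v / g ^+ 2.
Proof. by rewrite !mulr_ge0 ?invr_ge0 ?exprn_ge0 ?(ltW g0). Qed.

(** The commutator with the perturbation contributes [8 * b * v ^+ 2 / g ^+ 2], which lacks the
    factor [N]; [g <= 2 * N] turns it into at most [16 * N * b * v ^+ 2 / g ^+ 3]. *)
Lemma bound_overlap : g <= 2 * N ->
  4 * (2 * (N + v) * b) * v / g ^+ 2 <= 8 * N * b * (v + v ^+ 2) * ((g + 2) / g ^+ 3).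
Proof.
move=> gN; rewrite -subr_ge0.
have -> : 8 * N * b * (v + v ^+ 2) * ((g + 2) / g ^+ 3)
    - 4 * (2 * (N + v) * b) * v / g ^+ 2
  = 8 * (N * b * v ^+ 2 / g ^+ 2) + 16 * (N * b * v / g ^+ 3)
    + 8 * (b * v ^+ 2 / g ^+ 3 * (2 * N - g)).
  by field; rewrite gt_eqF.
have gi (k : nat) : 0 <= (g ^+ k)^-1 by rewrite invr_ge0 exprn_ge0 // ltW.
apply: addr_ge0; first by apply: addr_ge0; rewrite !mulr_ge0 ?exprn_ge0.
by rewrite !mulr_ge0 ?exprn_ge0 ?subr_ge0.
Qed.

End BoundArithmetic.

(** * Commuting Hamiltonians: the bound before any decay is used *)

Section CommutingModel.
Variables (R : realType) (T : finType) (q : nat).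
Variables (Psi : interaction R T q).
Hypotheses (intPsi : is_interaction Psi) (comPsi : commuting Psi).

Implicit Types (P : pred {set T}).

Definition partial_ham P : obs R T q := \sum_(Z | P Z) Psi Z.

Lemma selfadj_part P : selfadj (partial_ham P).
Proof.
rewrite /selfadj /partial_ham; elim/big_ind : _ => //.
- by rewrite /adj map_mx0 trmx0.
- by move=> A B sA sB; rewrite adjD sA sB.
- by move=> Z _; case: (intPsi Z).
Qed.

Lemma part_comm P (A : obs R T q) : (forall Z, P Z -> Psi Z *m A = A *m Psi Z) ->
  partial_ham P *m A = A *m partial_ham P.
Proof.
by move=> h; rewrite mulmx_suml mulmx_sumr; apply: eq_bigr => Z /h.
Qed.

Lemma part_part_comm P P' : partial_ham P *m partial_ham P' = partial_ham P' *m partial_ham P.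
Proof. by apply: part_comm => Z _; symmetry; apply: part_comm => Z' _; apply: comPsi. Qed.

Lemma hamiltonian_part P : hamiltonian Psi = partial_ham P + partial_ham (predC P).
Proof. exact: bigID. Qed.

(** A spin flip at [x] commutes with every term that avoids [x], so only the terms containing [x]
    limit the gap. *)
Lemma gap_le_site_norm (g : R) (x : T) : 0 < g -> (1 < q)%N ->
  unique_gs_gap (hamiltonian Psi) g ->
  g <= 2 * \sum_(Z : {set T} | x \in Z) opnorm (Psi Z).
Proof.
move=> g0 q1; rewrite (hamiltonian_part (fun Z => x \in Z)) => gap.
set K := partial_ham _ in gap; set G := partial_ham _ in gap.
have sKG : selfadj (K + G) by rewrite /selfadj adjD !selfadj_part.
have [psi [E gs]] := exists_gapped_ground_state sKG gap.
apply: (@le_trans _ _ (2 * opnorm K)); last by rewrite ler_wpM2l // opnorm_sum.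
have [psi1 _ _ _] := gs.
have [i psii] : exists i, psi i 0 != 0.
  apply/existsP; apply: contraT => /existsPn h; have := unit_neq0 psi1.
  suff -> : psi = 0 by rewrite eqxx.
  by apply/matrixP => i j; rewrite ord1 mxE; apply/eqP; have := h i; rewrite negbK.
(* The flip starts from the spin at [x] of a configuration with nonzero amplitude, so it cannot fix
   the line of [psi]. *)
pose s : conf T q := enum_val i.
have [b sb] : exists b : 'I_q, s x != b.
  have q0 : (0 < q)%N by apply: ltnW.
  have [e|ne] := eqVneq (s x) (Ordinal q0); last by exists (Ordinal q0).
  by exists (Ordinal q1); rewrite e.
apply: (gap_le_opnorm (F := site_flip R x (s x) b) _ _ g0 gs).
- exact: selfadj_part.
- exact: selfadj_part.
- exact: part_part_comm.
- symmetry; apply: part_comm => Z xZ; have [_ sZ] := intPsi Z.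
  apply: supported_comm sZ (supported_site_flip _ _ _ _) _.
  by rewrite disjoint_sym disjoints1.
- by move=> c; apply: (site_flip_not_eigen (s := s)) sb _; rewrite // /s enum_valK.
Qed.

(** [W], [S] and [C] collect the terms meeting both [X] and [Y], meeting [X] only, and avoiding [X].
    The number [N] has two roles: it bounds the norm of [W] and, at sites of the overlap, the site
    sums that limit the gap. *)
Lemma local_perturbation_bound (X Y : {set T}) (V B rho0 rho1 : obs R T q) (g N : R) :
  supported X V -> selfadj V -> supported Y B -> 0 < g ->
  (forall lam : R, 0 <= lam <= 1 ->
     unique_gs_gap (hamiltonian Psi + (lam%:C)%C *: V) g) ->
  ground_state_proj (hamiltonian Psi) rho0 ->
  ground_state_proj (hamiltonian Psi + V) rho1 ->
  \sum_(Z : {set T} | ~~ [disjoint Z & X] && ~~ [disjoint Z & Y]) opnorm (Psi Z) <= N ->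
  (forall x, x \in X -> x \in Y -> \sum_(Z : {set T} | x \in Z) opnorm (Psi Z) <= N) ->
  trace_diff rho0 rho1 B <=
    8 * N * opnorm B * (opnorm V + opnorm V ^+ 2) * ((g + 2) / g ^+ 3).
Proof.
move=> supV sV supB g0 gap gs0 gs1 hN hsite.
pose M := partial_ham (fun Z => ~~ [disjoint Z & X]).
pose C := partial_ham (fun Z => [disjoint Z & X]).
have eH : hamiltonian Psi = M + C.
  rewrite (hamiltonian_part (fun Z => ~~ [disjoint Z & X])); congr (_ + _).
  by apply: eq_bigl => Z /=; rewrite negbK.
pose W := partial_ham (fun Z => ~~ [disjoint Z & X] && ~~ [disjoint Z & Y]).
pose S := partial_ham (fun Z => ~~ [disjoint Z & X] && [disjoint Z & Y]).
have eM : M = W + S.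
  transitivity (W + partial_ham (fun Z => ~~ [disjoint Z & X] && ~~ ~~ [disjoint Z & Y])).
    exact: bigID.
  by congr (_ + _); apply: eq_bigl => Z; rewrite negbK.
have sH : selfadj (hamiltonian Psi) by rewrite eH /selfadj adjD !selfadj_part.
have comHC : hamiltonian Psi *m C = C *m hamiltonian Psi.
  by rewrite eH mulmxDl mulmxDr part_part_comm.
have comVC : V *m C = C *m V.
  symmetry; apply: part_comm => Z dZ; have [_ sZ] := intPsi Z.
  exact: supported_comm sZ supV dZ.
have comSB : S *m B = B *m S.
  apply: part_comm => Z /andP[_ dZ]; have [_ sZ] := intPsi Z.
  exact: supported_comm sZ supB dZ.
have N0 : 0 <= N by apply: le_trans hN; apply: sumr_ge0 => Z _; apply: opnorm_ge0.
have V0 := opnorm_ge0 V; have B0 := opnorm_ge0 B.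
have red (lam : R) : (hamiltonian Psi + (lam%:C)%C *: V - C) *m B
    - B *m (hamiltonian Psi + (lam%:C)%C *: V - C)
  = (W + (lam%:C)%C *: V) *m B - B *m (W + (lam%:C)%C *: V).
  have -> : hamiltonian Psi + (lam%:C)%C *: V - C = W + (lam%:C)%C *: V + S.
    by rewrite eH eM [_ + C + _]addrAC addrK addrAC.
  by rewrite mulmxDl mulmxDr comSB opprD addrACA subrr addr0.
have hW : opnorm W <= N by apply: le_trans hN; apply: opnorm_sum.
have main k k0 hk := expectation_perturb_bound (k := k) (B := B)
  sH sV (selfadj_part _) g0 k0 gap comHC comVC hk gs0 gs1.
have [dXY|] := boolP [disjoint X & Y].
  have comVB := supported_comm supV supB dXY.
  apply: le_trans (bound_disjoint g0 N0 B0 V0).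
  apply: main => [|lam _ v]; first exact: (commutator_bound_ge0 B0 N0).
  have -> : (hamiltonian Psi + (lam%:C)%C *: V - C) *m B
      - B *m (hamiltonian Psi + (lam%:C)%C *: V - C) = W *m B - B *m W.
    by rewrite red mulmxDl mulmxDr -scalemxAl comVB scalemxAr opprD addrACA subrr addr0.
  exact: commutator_le.
(* With at most one spin state there is nothing to flip; all observables then commute and the
   commutator constant is [0]. *)
have [q1 _|q1] := leqP q 1.
  apply: le_trans (le_trans _ (bound_disjoint g0 N0 B0 V0)).
    apply: (main 0) => // lam _ v.
    by rewrite (small_spin_comm _ B q1) subrr mul0mx vnorm0 mul0r.
  by rewrite mulr0 !mul0r; exact: (derivative_bound_ge0 g0 N0 B0 V0).
rewrite disjoint_subset => /subsetPn[x xX]; rewrite inE negbK => xY.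
have gN : g <= 2 * N.
  have gap0 : unique_gs_gap (hamiltonian Psi) g.
    by have := gap 0; rewrite scale0r addr0 lexx ler01; apply.
  by apply: le_trans (gap_le_site_norm x g0 q1 gap0) _; rewrite ler_wpM2l // hsite.
apply: le_trans (bound_overlap g0 N0 B0 V0 gN).
apply: main => [|lam /andP[l0 l1] v].
  exact: (commutator_bound_ge0 B0 (addr_ge0 N0 V0)).
rewrite red; apply: commutator_le.
apply: opnorm_le => [|w].
  exact: (addr_ge0 N0 V0).
rewrite mulmxDl mulrDl; apply: (le_trans (vnormD _ _)); apply: lerD.
  by apply: (le_trans (vnorm_mul_le _ _)); apply: ler_wpM2r hW; apply: vnorm_ge0.
rewrite -scalemxAl vnormZ normc_real ger0_norm //.
by apply: le_trans (vnorm_mul_le _ _); apply: ler_piMl => //; apply: vnorm_ge0.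
Qed.

End CommutingModel.

(** * Graph distance and distance between sets *)

Section GraphDistance.
Variables (T : finType) (e : rel T).
Implicit Types (x y : T) (X Y : {set T}).

Lemma withinP n x y :
  reflect (exists p, [/\ path e x p, last x p = y & (size p <= n)%N]) (within e n x y).
Proof.
elim: n y => [|n IH] y /=.
  apply: (iffP eqP) => [->|[[|z p] [_ <-]] //]; by exists [::].
apply: (iffP orP) => [[/IH[p [ep lp sp]]|/existsP[z /andP[/IH[p [ep lp sp]] ezy]]]|].
- by exists p; split=> //; apply: ltnW.
- by exists (rcons p y); rewrite rcons_path ep lp ezy last_rcons size_rcons.
move=> [p]; case: (lastP p) => [|p' z] [].
  by move=> _ <- _; left; apply/IH; exists [::].
rewrite rcons_path last_rcons size_rcons ltnS => /andP[ep ez] <- sp; right.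
by apply/existsP; exists (last x p'); rewrite ez andbT; apply/IH; exists p'.
Qed.

Lemma within_sym n x y : symmetric e -> within e n x y -> within e n y x.
Proof.
move=> se /withinP[p [ep <- sp]]; apply/withinP; exists (rev (belast x p)).
rewrite size_rev size_belast rev_path; split=> //.
  by rewrite (eq_path (e' := e)) // => u v; rewrite se.
by case: p {ep sp} => //= z p; rewrite rev_cons last_rcons.
Qed.

Lemma gdist_sym x y : symmetric e -> gdist e x y = gdist e y x.
Proof.
by move=> se; apply: eq_find => n; apply/idP/idP; apply: within_sym.
Qed.

Lemma gdist_refl x : gdist e x x = 0%N.
Proof.
rewrite /gdist; have : (0 < #|T|)%N by apply/card_gt0P; exists x.
by case: #|T| => //= n _; rewrite eqxx.
Qed.

Lemma gdist_le_card x y : (gdist e x y <= #|T|)%N.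
Proof. by rewrite -[X in (_ <= X)%N](size_iota 0) find_size. Qed.

Lemma big_minn_le (I : finType) (P : pred I) (F : I -> nat) m i :
  P i -> (\big[minn/m]_(j | P j) F j <= F i)%N.
Proof.
move=> Pi; have : i \in index_enum I by apply: mem_index_enum.
elim: (index_enum I) => //= j s IH; rewrite inE big_cons => /predU1P[<-|/IH le].
  by rewrite Pi geq_minl.
by case: ifP => // _; apply: leq_trans le; apply: geq_minr.
Qed.

Lemma setdist_le X Y x y : x \in X -> y \in Y -> (setdist e X Y <= gdist e x y)%N.
Proof.
move=> xX yY; apply: leq_trans (big_minn_le _ _ xX) _.
exact: (big_minn_le (gdist e x)).
Qed.

Lemma setdist_overlap X Y x : x \in X -> x \in Y -> setdist e X Y = 0%N.
Proof.
by move=> xX xY; apply/eqP; rewrite -leqn0 -(gdist_refl x) setdist_le.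
Qed.

End GraphDistance.

(** * Decay functions and their summability on regular graphs *)

Section DecayFunctions.
Variable R : realType.
Implicit Types (r s : nat).

Lemma F_poly_gt0 (alpha : R) r : 0 < F_poly alpha r.
Proof. by apply: powR_gt0; rewrite ltr_pwDl. Qed.

Lemma F_poly0 (alpha : R) : F_poly alpha 0 = 1.
Proof. by rewrite /F_poly addr0 powR1. Qed.

Lemma F_poly_anti (alpha : R) r s : 0 < alpha -> (r <= s)%N ->
  F_poly alpha s <= F_poly alpha r.
Proof.
move=> a0 rs; rewrite /F_poly !powRN lef_pV2 ?posrE ?powR_gt0 ?ltr_pwDl //.
by apply: ge0_ler_powR; rewrite ?nnegrE ?addr_ge0 ?lerD2l ?ler_nat // ltW.
Qed.

Lemma F_exp_gt0 (b p : R) r : 0 < F_exp b p r.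
Proof. exact: expR_gt0. Qed.

Lemma F_exp0 (b p : R) : 0 < p -> F_exp b p 0 = 1.
Proof. by move=> p0; rewrite /F_exp powR0 ?gt_eqF // mulr0 oppr0 expR0. Qed.

Lemma F_exp_anti (b p : R) r s : 0 < b -> 0 < p -> (r <= s)%N ->
  F_exp b p s <= F_exp b p r.
Proof.
move=> b0 p0 rs; rewrite ler_expR lerN2 ler_wpM2l ?(ltW b0) //.
by apply: ge0_ler_powR; rewrite ?nnegrE ?ler_nat ?ler0n // ltW.
Qed.

Lemma F_expD (b c p : R) r : F_exp (b + c) p r = F_exp b p r * F_exp c p r.
Proof. by rewrite /F_exp -expRD -opprD mulrDl. Qed.

(** Telescoping: [1/(m+1)^2] is at most [1/m - 1/(m+1)], the difference being [1/(m (m+1)^2)]. *)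
Lemma sum_inv_sqr_le n : \sum_(i < n.+1) ((i.+1%:R : R) ^+ 2)^-1 <= 2 - n.+1%:R^-1.
Proof.
elim: n => [|n IH]; first by rewrite big_ord1 expr1n invr1; lra.
rewrite big_ord_recr /=; apply: (le_trans (lerD IH (lexx _))).
have m0 : 0 < n.+1%:R :> R by rewrite ltr0Sn.
rewrite -[n.+2%:R]natr1; move: (n.+1%:R : R) m0 => m m0.
rewrite -subr_ge0.
have -> : 2 - (m + 1)^-1 - (2 - m^-1 + ((m + 1) ^+ 2)^-1) = (m * (m + 1) ^+ 2)^-1.
  by field; rewrite !gt_eqF // addr_gt0.
by rewrite invr_ge0 mulr_ge0 ?sqr_ge0 ?ltW.
Qed.

(* [exp u >= u^k / k!] with [u = c r^p] and [k p >= D + 2]. *)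
Lemma powR_F_exp_le (c p D : R) : 0 < c -> 0 < p -> exists K : R, 0 <= K /\
  forall r, powR (r.+1%:R) D * F_exp c p r.+1 <= K * (r.+1%:R ^+ 2)^-1.
Proof.
move=> c0 p0.
have h0 : 0 <= (`|D| + 2) / p by rewrite divr_ge0 ?addr_ge0 ?(ltW p0).
have hk := archi_boundP h0; set k := Num.bound _ in hk.
have Dk : D + 2 <= p * k.+1%:R.
  rewrite ltr_pdivrMr // in hk.
  rewrite -[k.+1%:R]natr1 mulrDr mulr1 (mulrC p); have := ler_norm D; lra.
exists (k.+1`!%:R / c ^+ k.+1); split; first by rewrite divr_ge0 // exprn_ge0 ?ltW.
move=> r; set x : R := r.+1%:R.
have x1 : 1 <= x by rewrite ler1n.
have x0 : 0 < x by rewrite ltr0Sn.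
pose u := c * powR x p.
have u0 : 0 <= u by rewrite mulr_ge0 ?powR_ge0 ?ltW.
have f0 : 0 < k.+1`!%:R :> R by rewrite ltr0n fact_gt0.
rewrite /F_exp -/u expRN ler_pdivlMr ?exprn_gt0 // mulrAC ler_pdivrMr ?expR_gt0 //.
rewrite -(powR_mulrn 2 (ltW x0)).
rewrite -powRD; last by rewrite (gt_eqF x0) implybT.
apply: (@le_trans _ _ (powR x (p * k.+1%:R))); first exact: ler_powR.
rewrite powRrM powR_mulrn ?powR_ge0 // mulrAC ler_pdivlMr ?exprn_gt0 // -exprMn mulrC -/u.
have := expR_ge1Dxn k u0.
rewrite -(@ler_pM2l _ k.+1`!%:R) // mulrDr mulr1 mulrCA divff ?gt_eqF // mulr1.
by apply: le_trans; rewrite lerDr ltW.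
Qed.

(** Sum over distance shells: the shell at distance [n > 0] has at most [k n^D] sites and
    contributes at most [k K / n^2]. [C] is fixed before the graph, and [1 <= C] serves the case of
    overlapping sets. *)
Lemma regular_sum_F_exp (c p kappa D : R) : 0 < c -> 0 < p -> exists C : R, 1 <= C /\
  forall (T : finType) (e : rel T), kD_regular e kappa D ->
  forall x, \sum_y F_exp c p (gdist e x y) <= C.
Proof.
move=> c0 p0; have [K [K0 hK]] := powR_F_exp_le D c0 p0.
exists (1 + `|1 + kappa| * (1 + 2 * K)).
split; first by rewrite lerDl mulr_ge0 // addr_ge0 // mulr_ge0.
move=> T e reg x; set k := `|1 + kappa|.
have k0 : 0 <= k by apply: normr_ge0.
have ball n : (0 < n)%N -> #|[set y | (gdist e x y <= n)%N]|%:R <= k * powR (n%:R : R) D.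
  move=> n0; apply: (le_trans (reg x n n0)); rewrite ler_wpM2r ?powR_ge0 //.
  exact: ler_norm.
(* Distances never exceed [#|T|], so [inord] truncates nothing. *)
pose d y : 'I_(#|T|.+1) := inord (gdist e x y).
have dE y : d y = gdist e x y :> nat by rewrite inordK // ltnS gdist_le_card.
rewrite (partition_big d xpredT) //=.
(* Regularity concerns positive radii only, so the shell at distance zero is bounded by the ball of
   radius one, whence [maxn n 1]. *)
have shell n : \sum_(y | d y == n) F_exp c p (gdist e x y)
    <= #|[set y | (gdist e x y <= maxn n 1)%N]|%:R * F_exp c p n.
  rewrite (eq_bigr (fun=> F_exp c p n)) => [|y /eqP <-]; last by rewrite dE.
  rewrite sumr_const -[X in X <= _]mulr_natl ler_wpM2r ?(ltW (F_exp_gt0 _ _ _)) // ler_nat.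
  by apply: subset_leq_card; apply/fintype.subsetP => y; rewrite !inE -dE => /eqP ->; apply: leq_maxl.
apply: (le_trans (ler_sum _ (fun n _ => shell n))).
rewrite big_ord_recl /= F_exp0 // mulr1.
have -> : 1 + k * (1 + 2 * K) = 1 + k + k * (K * 2) by ring.
apply: lerD.
  by apply: (le_trans (ball 1%N _)); rewrite // powR1 mulr1 lerDr.
case: #|T| => [|n]; first by rewrite big_ord0 !mulr_ge0.
apply: (@le_trans _ _ (k * (K * \sum_(i < n.+1) ((i.+1%:R : R) ^+ 2)^-1))).
  rewrite !mulr_sumr; apply: ler_sum => i _; rewrite /= /bump add1n.
  rewrite (maxn_idPl _) //.
  apply: (@le_trans _ _ (k * powR i.+1%:R D * F_exp c p i.+1)).
    by rewrite ler_wpM2r ?ball // ltW // F_exp_gt0.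
  by rewrite -mulrA ler_wpM2l.
rewrite !ler_wpM2l //; apply: (le_trans (sum_inv_sqr_le n)).
by rewrite lerBlDr lerDl invr_ge0.
Qed.

End DecayFunctions.

(** * Sums of interaction terms bounded by the interaction norm *)

Section InteractionNorm.
Variables (R : realType) (T : finType) (e : rel T) (q : nat).
Variables (Psi : interaction R T q) (F : nat -> R).
Hypothesis F_gt0 : forall r, 0 < F r.
Implicit Types (X Y : {set T}).

Lemma Fnorm_ge0 : 0 <= Fnorm e F Psi.
Proof. exact: bigmax_ge_id. Qed.

Lemma pair_norm_le x y :
  \sum_(Z : {set T} | (x \in Z) && (y \in Z)) opnorm (Psi Z)
    <= Fnorm e F Psi * F (gdist e x y).
Proof.
rewrite -ler_pdivrMr //; apply: le_trans (le_bigmax _ _ x).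
exact: (le_bigmax _ (fun y => (\sum_(Z : {set T} | (x \in Z) && (y \in Z)) opnorm (Psi Z))
  / F (gdist e x y)) y).
Qed.

Lemma site_norm_le x : F 0 = 1 ->
  \sum_(Z : {set T} | x \in Z) opnorm (Psi Z) <= Fnorm e F Psi.
Proof.
move=> F0; have := pair_norm_le x x; rewrite gdist_refl F0 mulr1.
by under eq_bigl => Z do rewrite andbb.
Qed.

(** A union bound: every [Z] meeting both sets contains at least one pair [(x, y)] from them, so it
    is counted in the double sum. *)
Lemma meeting_norm_le X Y :
  \sum_(Z : {set T} | ~~ [disjoint Z & X] && ~~ [disjoint Z & Y]) opnorm (Psi Z)
    <= Fnorm e F Psi * \sum_(x in X) \sum_(y in Y) F (gdist e x y).
Proof.
apply: (@le_trans _ _ (\sum_(x in X) \sum_(y in Y)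
    \sum_(Z : {set T} | (x \in Z) && (y \in Z)) opnorm (Psi Z))); last first.
  rewrite mulr_sumr; apply: ler_sum => x _.
  by rewrite mulr_sumr; apply: ler_sum => y _; apply: pair_norm_le.
rewrite pair_big /= (exchange_big_dep xpredT) //= [X in X <= _]big_mkcond /=.
apply: ler_sum => Z _.
have pos : 0 <= opnorm (Psi Z) by apply: opnorm_ge0.
case: ifP => [/andP[]|_]; last exact: sumr_ge0.
rewrite -!setI_eq0 => /set0Pn[x /setIP[xZ xX]] /set0Pn[y /setIP[yZ yY]].
rewrite (bigD1 (x, y)) /=; last by rewrite xX yY xZ yZ.
by rewrite lerDl; apply: sumr_ge0.
Qed.

End InteractionNorm.

(** * From local bounds to decay in the distance of the sets *)

Section DecayingInteraction.
Variables (R : realType) (T : finType) (e : rel T) (q : nat).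
Variables (Psi : interaction R T q) (F : nat -> R) (X Y : {set T}).
Hypotheses (F_gt0 : forall r, 0 < F r) (F0 : F 0 = 1).

Lemma trace_diff_le_decay (V B rho0 rho1 : obs R T q) (g N : R) :
  is_interaction Psi -> commuting Psi ->
  supported X V -> selfadj V -> supported Y B -> 0 < g ->
  (forall lam : R, 0 <= lam <= 1 ->
     unique_gs_gap (hamiltonian Psi + (lam%:C)%C *: V) g) ->
  ground_state_proj (hamiltonian Psi) rho0 ->
  ground_state_proj (hamiltonian Psi + V) rho1 ->
  \sum_(x in X) \sum_(y in Y) F (gdist e x y) <= N ->
  (forall x, x \in X -> x \in Y -> 1 <= N) ->
  trace_diff rho0 rho1 B <= 8 * (Fnorm e F Psi * N) * opnorm B
    * (opnorm V + opnorm V ^+ 2) * ((g + 2) / g ^+ 3).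
Proof.
move=> intPsi comPsi supV sV supB g0 gap gs0 gs1 hN N1.
have f0 := Fnorm_ge0 e Psi F.
apply: (local_perturbation_bound intPsi comPsi supV sV supB g0 gap gs0 gs1).
  apply: le_trans (meeting_norm_le _ _ F_gt0 _ _) _.
  exact: ler_wpM2l.
move=> x xX xY; apply: le_trans (site_norm_le _ _ F_gt0 x F0) _.
by apply: ler_peMr => //; apply: N1 xX xY.
Qed.

Lemma pair_sum_le : (forall r s, (r <= s)%N -> F s <= F r) ->
  \sum_(x in X) \sum_(y in Y) F (gdist e x y)
    <= #|X|%:R * #|Y|%:R * F (setdist e X Y).
Proof.
move=> F_anti.
apply: (@le_trans _ _ (\sum_(x in X) \sum_(y in Y) F (setdist e X Y))).
  by apply: ler_sum => x xX; apply: ler_sum => y yY; apply/F_anti/setdist_le.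
by rewrite !sumr_const -mulrnA mulnC -[X in X <= _]mulr_natl natrM.
Qed.

(** [F] is bounded by its value at the distance of the sets. Summing [G] over one set is extended to
    the whole graph at cost [C], so only the other set is counted; symmetry of the distance lets
    this be the smaller one. *)
Lemma pair_sum_regular_le (G : nat -> R) (C : R) : symmetric e ->
  (forall r s, (r <= s)%N -> F s <= F r) -> (forall r, 0 <= G r) ->
  (forall x, \sum_y G (gdist e x y) <= C) ->
  \sum_(x in X) \sum_(y in Y) F (gdist e x y) * G (gdist e x y)
    <= C * (minn #|X| #|Y|)%:R * F (setdist e X Y).
Proof.
move=> se F_anti G0 hC.
have Fle x y : x \in X -> y \in Y -> F (gdist e x y) <= F (setdist e X Y).
  by move=> xX yY; apply/F_anti/setdist_le.
have half (A A' : {set T}) (f : T -> T -> R) :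
    (forall x y, x \in A -> y \in A' -> f x y <= F (setdist e X Y) * G (gdist e x y)) ->
    \sum_(x in A) \sum_(y in A') f x y <= C * #|A|%:R * F (setdist e X Y).
  move=> hf; apply: (@le_trans _ _ (\sum_(x in A) F (setdist e X Y) * C)).
    apply: ler_sum => x xA.
    apply: (@le_trans _ _ (F (setdist e X Y) * \sum_(y in A') G (gdist e x y))).
      by rewrite mulr_sumr; apply: ler_sum => y yA; apply: hf.
    apply: ler_wpM2l; first exact: ltW.
    apply: le_trans (hC x); rewrite [X in X <= _]big_mkcond /=.
    by apply: ler_sum => y _; case: ifP.
  by rewrite sumr_const -[X in X <= _]mulr_natl mulrA [X in X <= _]mulrC mulrA.
rewrite /minn; case: ifP => _.
  by apply: half => x y xX yY; apply: ler_wpM2r => //; apply: Fle.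
rewrite exchange_big /=; apply: half => y x yY xX.
by rewrite [gdist e y x]gdist_sym //; apply: ler_wpM2r => //; apply: Fle.
Qed.

End DecayingInteraction.

(** * Polynomial and stretched-exponential decay *)

Theorem theorem4p3 (R : realType) :
  (* (a) polynomially decaying commuting interactions *)
  (forall (T : finType) (e : rel T) (q : nat) (Psi : interaction R T q)
          (X : {set T}) (V : obs R T q) (g alpha : R),
      simple_connected_graph e ->
      is_interaction Psi -> commuting Psi ->
      supported X V -> selfadj V ->
      0 < g ->
      (forall lam : R, 0 <= lam <= 1 ->
         unique_gs_gap (hamiltonian Psi + (lam%:C)%C *: V) g) ->
      0 < alpha ->
      forall rho0 rho1 : obs R T q,
      ground_state_proj (hamiltonian Psi) rho0 ->
      ground_state_proj (hamiltonian Psi + V) rho1 ->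
      forall (Y : {set T}) (B : obs R T q), supported Y B ->
        trace_diff rho0 rho1 B <=
          32 * Fnorm e (F_poly alpha) Psi * opnorm B
             * (opnorm V + opnorm V ^+ 2) * #|X|%:R * #|Y|%:R
             * F_poly alpha (setdist e X Y) * ((g + 2) / g ^+ 3))
  /\
  (* (b) stretched-exponentially decaying interactions on regular graphs *)
  (forall (b b' p kappa D : R),
      0 < b' -> b' < b -> 0 < p -> p <= 1 ->
      exists C : R, 0 < C /\
      forall (T : finType) (e : rel T) (q : nat) (Psi : interaction R T q)
             (X : {set T}) (V : obs R T q) (g : R),
        simple_connected_graph e ->
        kD_regular e kappa D ->
        is_interaction Psi -> commuting Psi ->
        supported X V -> selfadj V ->
        0 < g ->
        (forall lam : R, 0 <= lam <= 1 ->
           unique_gs_gap (hamiltonian Psi + (lam%:C)%C *: V) g) ->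
        forall rho0 rho1 : obs R T q,
        ground_state_proj (hamiltonian Psi) rho0 ->
        ground_state_proj (hamiltonian Psi + V) rho1 ->
        forall (Y : {set T}) (B : obs R T q), supported Y B ->
          trace_diff rho0 rho1 B <=
            8 * C * Fnorm e (F_exp b p) Psi * opnorm B
              * (opnorm V + opnorm V ^+ 2) * (minn #|X| #|Y|)%:R
              * F_exp b' p (setdist e X Y) * ((g + 2) / g ^+ 3)).
split.
  move=> T e q Psi X V g alpha _ intPsi comPsi supV sV g0 gap alpha0 rho0 rho1 gs0 gs1 Y B supB.
  have F_gt0 := F_poly_gt0 alpha; have F_0 := F_poly0 alpha.
  have hN := pair_sum_le e X Y (fun r s => F_poly_anti alpha0).
  have h := trace_diff_le_decay F_gt0 F_0 intPsi comPsi supV sV supB g0 gap gs0 gs1 hN.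
  apply: le_trans (h _) _ => [x xX xY|].
    rewrite (setdist_overlap e xX xY) F_0 mulr1 -natrM ler1n muln_gt0.
    by apply/andP; split; apply/card_gt0P; exists x.
  set f := Fnorm _ _ _; set b := opnorm B; set v := opnorm V; set F := F_poly _ _.
  have f0 : 0 <= f by apply: Fnorm_ge0.
  have b0 : 0 <= b by apply: opnorm_ge0.
  have v0 : 0 <= v by apply: opnorm_ge0.
  have F0 : 0 <= F by apply: ltW (F_gt0 _).
  clearbody f b v F; clear - f0 b0 v0 F0 g0.
  set w := (v + _); set c := (_ / _).
  have w0 : 0 <= w by rewrite addr_ge0 ?exprn_ge0.
  have c0 : 0 <= c by rewrite divr_ge0 ?exprn_ge0 ?addr_ge0 // ltW.
  clearbody w c; set nX : R := #|X|%:R; set nY : R := #|Y|%:R.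
  (* The argument yields the constant 8, a quarter of the stated 32. *)
  have -> : 32 * f * b * w * nX * nY * F * c = 4 * (8 * (f * (nX * nY * F)) * b * w * c) by ring.
  by rewrite ler_peMl ?ler1n // !mulr_ge0.
move=> b b' p kappa D b'0 bb' p0 _.
(* The surplus rate [b - b'] pays for the sum over the graph, whose uniform bound is the constant
   [C]; the rate [b'] remains for the decay in the distance. *)
have d0 : 0 < b - b' by lra.
have [C [C1 hC]] := regular_sum_F_exp kappa D d0 p0.
have C0 : 0 < C by apply: lt_le_trans C1.
exists C; split=> // T e q Psi X V g [se _] reg intPsi comPsi supV sV g0 gap
  rho0 rho1 gs0 gs1 Y B supB.
have F_gt0 := F_exp_gt0 b p; have F_0 := F_exp0 b p0.
have eF r : F_exp b p r = F_exp b' p r * F_exp (b - b') p r.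
  by rewrite -F_expD addrC subrK.
have hN : \sum_(x in X) \sum_(y in Y) F_exp b p (gdist e x y)
    <= C * (minn #|X| #|Y|)%:R * F_exp b' p (setdist e X Y).
  under eq_bigr => x _ do under eq_bigr => y _ do rewrite eF.
  exact: (pair_sum_regular_le X Y (F_exp_gt0 b' p) se (fun r s => F_exp_anti b'0 p0)
    (fun r => ltW (F_exp_gt0 (b - b') p r)) (hC T e reg)).
have h := trace_diff_le_decay F_gt0 F_0 intPsi comPsi supV sV supB g0 gap gs0 gs1 hN.
apply: le_trans (h _) _ => [x xX xY|].
  rewrite (setdist_overlap e xX xY) F_exp0 // mulr1.
  apply: (le_trans C1); rewrite (ler_peMr (ltW C0)) // ler1n leq_min.
  by apply/andP; split; apply/card_gt0P; exists x.
have assoc (f m l n w k : R) :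
    8 * (f * (C * m * l)) * n * w * k = 8 * C * f * n * w * m * l * k by ring.
by rewrite assoc.
Qed.
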